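(* Let $d,b\ge1$ with $M=2^b<d$, and $\varepsilon>0$. Consider the rotationally symmetric simplex codebooks $U^M=(rAs_1,\dots,rAs_M)$, $r>0$, with $A$ a uniformly (Haar) distributed $d\times d$ orthogonal matrix. Then there exist $k$ and $r>0$ such that the $k$-closest encoding with the codebook $(rAs_1,\dots,rAs_M)$ is unbiased and $\varepsilon$-LDP, and its worst-case error is at most $\mathrm{Err}(f,P_{U'^M})$ for every $r'>0$ and every random encoder $f$ that is unbiased and $\varepsilon$-LDP with respect to the codebook $U'^M=(r'As_1,\dots,r'As_M)$; i.e. the $k$-closest encoding is the exact-optimum unbiased $\varepsilon$-LDP scheme for the rotationally symmetric simplex codebook.
   Context: $\mathbb{S}^{d-1}$ is the unit sphere in $\mathbb{R}^d$, $[M]=\{1,\dots,M\}$. The simplex vectors $s_1,\dots,s_M\in\mathbb{R}^d$ are $(s_i)_j=\frac{M-1}{\sqrt{M(M-1)}}$ if $j=i$, $(s_i)_j=-\frac{1}{\sqrt{M(M-1)}}$ if $j\ne i$, $j\le M$, and $(s_i)_j=0$ if $j>M$. Server and user share the random codebook $U^M=(U_1,\dots,U_M)$; a random encoder $f:\mathbb{S}^{d-1}\times(\mathbb{R}^d)^M\to[M]$ has transition probabilities $Q_f(m\mid v,u^M)$, and the server decodes $m$ as $U_m$. The encoder is $\varepsilon$-LDP if $Q_f(m\mid v,u^M)\le e^\varepsilon Q_f(m\mid v',u^M)$ for all $v,v'\in\mathbb{S}^{d-1}$, $m$ and almost all $u^M$; unbiased if $\mathbb{E}[\sum_{m=1}^M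 U_mQ_f(m\mid v,U^M)]=v$ for all $v\in\mathbb{S}^{d-1}$; its worst-case error is $\mathrm{Err}(f,P_{U^M})=\sup_{v\in\mathbb{S}^{d-1}}\mathbb{E}[\sum_{m=1}^M\|U_m-v\|_2^2Q_f(m\mid v,U^M)]$. For real $k\in[0,M]$, the $k$-closest encoding sets $Q_f(m\mid v,U^M)=\frac{e^\varepsilon}{ke^\varepsilon+M-k}$ if $\|v-U_m\|^2$ is among the $\lfloor k\rfloor$ smallest of $\|v-U_1\|^2,\dots,\|v-U_M\|^2$, $\frac{(k-\lfloor k\rfloor)(e^\varepsilon-1)+1}{ke^\varepsilon+M-k}$ if it is the $(\lfloor k\rfloor+1)$-th smallest, and $\frac{1}{ke^\varepsilon+M-k}$ otherwise (ties broken arbitrarily). *)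

(* Defs.v *)
From HB Require Import structures.
From mathcomp Require Import all_boot all_order all_algebra.
From mathcomp Require Import all_classical all_reals all_analysis.
Set Implicit Arguments. Unset Strict Implicit. Unset Printing Implicit Defensive.
Import Order.TTheory GRing.Theory Num.Theory.
Local Open Scope classical_set_scope.
Local Open Scope ring_scope.

Section Defs.
Variable R : realType.

Definition sqnorm (d : nat) (x : 'cV[R]_d) : R := \sum_(j < d) (x j 0) ^+ 2.

Definition on_sphere (d : nat) (v : 'cV[R]_d) : Prop := sqnorm v = 1.

Definition simplex_vec (d M : nat) (i : 'I_M) : 'cV[R]_d :=
  \col_(j < d)
    (if (j < M)%N then
       (if (j : nat) == (i : nat)
        then (M%:R - 1) / Num.sqrt (M%:R * (M%:R - 1))
        else - 1 / Num.sqrt (M%:R * (M%:R - 1)))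
     else 0).

Definition simplex_codebook (d M : nat) (r : R) (A : 'M[R]_d) : 'I_M -> 'cV[R]_d :=
  fun m => r *: (A *m simplex_vec d m).

Definition orthogonal_mx (n : nat) (A : 'M[R]_n) : Prop := A^T *m A = 1%:M.

(* Borel sigma-algebra on matrices: generated by the entry coordinates *)
Definition mx_measurable (n : nat) (B : set 'M[R]_n) : Prop :=
  g_sigma_preimage (fun (i : 'I_(n * n)) (X : 'M[R]_n) => mxvec X 0 i) B.

(* A : T -> 'M_n is a Haar-distributed (uniform) random orthogonal matrix
   on the probability space (T, P): it is orthogonal, measurable, and its law
   is invariant under left multiplication by any orthogonal matrix
   (this characterizes the Haar probability measure on O(n)). *)
Definition haar_random_orthogonal (dm : measure_display) (T : measurableType dm)
    (P : probability T R) (n : nat) (A : T -> 'M[R]_n) : Prop :=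
  [/\ (forall t, orthogonal_mx (A t)),
      (forall i j, measurable_fun [set: T] (fun t => A t i j)) &
      (forall Q : 'M[R]_n, orthogonal_mx Q -> forall B : set 'M[R]_n,
          mx_measurable B ->
          P (A @^-1` B) = P ((fun t => Q *m A t) @^-1` B))].

(* An encoder: transition probabilities Q(m | v, u^M). *)
Definition encoder (d M : nat) := 'cV[R]_d -> ('I_M -> 'cV[R]_d) -> 'I_M -> R.

(* random encoder w.r.t. the random codebook U : transition probabilities,
   measurable in the randomness (so that the expectations make sense). *)
Definition random_encoder (dm : measure_display) (T : measurableType dm)
    (d M : nat) (U : T -> 'I_M -> 'cV[R]_d) (Q : encoder d M) : Prop :=
  [/\ (forall v u m, 0 <= Q v u m),
      (forall v u, \sum_(m < M) Q v u m = 1) &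
      (forall v m, measurable_fun [set: T] (fun t => Q v (U t) m))].

Definition is_LDP (dm : measure_display) (T : measurableType dm)
    (P : probability T R) (d M : nat) (U : T -> 'I_M -> 'cV[R]_d)
    (Q : encoder d M) (eps : R) : Prop :=
  forall v v' m, on_sphere v -> on_sphere v' ->
    {ae P, forall t, Q v (U t) m <= expR eps * Q v' (U t) m}.

Definition unbiased (dm : measure_display) (T : measurableType dm)
    (P : probability T R) (d M : nat) (U : T -> 'I_M -> 'cV[R]_d)
    (Q : encoder d M) : Prop :=
  forall v, on_sphere v -> forall j : 'I_d,
    (\int[P]_t (\sum_(m < M) U t m j 0 * Q v (U t) m)%:E = (v j 0)%:E)%E.

Definition worst_err (dm : measure_display) (T : measurableType dm)
    (P : probability T R) (d M : nat) (U : T -> 'I_M -> 'cV[R]_d)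
    (Q : encoder d M) : \bar R :=
  ereal_sup [set (\int[P]_t (\sum_(m < M) sqnorm (U t m - v) * Q v (U t) m)%:E)%E
            | v in @on_sphere d].

Definition dist_rank (M : nat) (dist : 'I_M -> R) (m : 'I_M) : nat :=
  #|[pred m' : 'I_M | (dist m' < dist m) || ((dist m' == dist m) && (m' < m)%N)]|.

Definition kclosest (d M : nat) (eps k : R) : encoder d M :=
  fun v u m =>
    let rho := dist_rank (fun m' => sqnorm (v - u m')) m in
    let den := k * expR eps + M%:R - k in
    if (Posz rho < Num.floor k)%R then expR eps / den
    else if Posz rho == Num.floor k then
      ((k - (Num.floor k)%:~R) * (expR eps - 1) + 1) / den
    else 1 / den.

End Defs.

Arguments simplex_codebook {R} d M r A.
Arguments kclosest {R} d M eps k.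

(* Main.v *)
Require Import Defs.
From HB Require Import structures.
From mathcomp Require Import all_boot all_order all_algebra.
From mathcomp Require Import all_classical all_reals all_analysis.
From mathcomp Require Import fingroup perm measurable_realfun.
From mathcomp Require Import ring lra.
Import Order.TTheory GRing.Theory Num.Theory.
Local Open Scope classical_set_scope.
Local Open Scope ring_scope.

(* An unbiased scheme with radius r has error r^2 - 1 at every v, and its mean
   alignment E[sum_m <A s_m, v> Q(m)] is 1/r; so the optimal scheme is the one of
   maximal mean alignment.  For fixed v and A this is a linear program in Q(.) with
   constraints p_m <= Q(m) <= e^eps p_m, where p_m is the infimum of Q(m) over inputs.
   Write a_m = <A s_m, v>, a_(1) >= ... >= a_(M), and let k maximise the mean alignment
   c of k-closest encoding over integers.  Comparing k with k - 1 and k + 1 gives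
   E a_(k+1) <= c <= E a_(k), so some fixed convex combination l of a_(k) and a_(k+1)
   has mean c.  Using l as dual variable bounds the alignment by l + sum_m p_m g_m,
   where g_m = e^eps (a_m - l)^+ - (a_m - l)^- has mean 0, by exchangeability of the a_m
   and since sum_m g_m has mean 0.

   As p depends on A but not on v, the p-term must be averaged over v with A fixed; since
   an encoder need not be measurable in v, this is done with finitely many points v_i,
   chosen so that the empirical means of the g_m are small in L^2.

   Conversely k-closest encoding is equivariant, so the mean of the decoded vector is
   fixed by the reflection through the line of v, hence equals r c v. *)

(** * Ranks and sums of the largest values *)

Section Ranks.
Context {R : realType} {M : nat}.
Implicit Types (a b : 'I_M -> R) (m : 'I_M).

(** The order counted by [dist_rank]. Breaking ties by index makes it a strict total order, so the
    ranks run exactly through [0, ..., M - 1]. *)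
Definition closer (a : 'I_M -> R) (m' m : 'I_M) : bool := (a m' < a m) || ((a m' == a m) && (m' < m)%N).

Lemma closer_irr a m : closer a m m = false.
Proof. by rewrite /closer ltxx ltnn andbF. Qed.

Lemma closer_trans a : transitive (closer a).
Proof.
move=> y x z /orP[xy|/andP[/eqP xy xy']] /orP[yz|/andP[/eqP yz yz']]; apply/orP.
- by left; apply: lt_trans yz.
- by left; rewrite -yz.
- by left; rewrite xy.
- by right; rewrite xy yz eqxx (ltn_trans xy').
Qed.

Lemma closer_total a m m' : m != m' -> closer a m m' || closer a m' m.
Proof.
rewrite /closer; case: (ltgtP (a m) (a m')) => //= _.
by rewrite -val_eqE /=; case: ltngtP.
Qed.

Lemma dist_rankE a m : dist_rank a m = #|[pred m' | closer a m' m]|.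
Proof. by []. Qed.

Lemma dist_rank_lt a m m' : closer a m m' -> (dist_rank a m < dist_rank a m')%N.
Proof.
move=> mm'; apply: proper_card; apply/properP; split.
  by apply/fintype.subsetP => x; rewrite !inE => xm; exact: closer_trans mm'.
by exists m; rewrite inE //; exact/negbT/closer_irr.
Qed.

Lemma dist_rank_ltE a m m' : (dist_rank a m < dist_rank a m')%N = closer a m m'.
Proof.
apply/idP/idP => [lt_mm'|]; last exact: dist_rank_lt.
have [eq_mm'|ne_mm'] := eqVneq m m'; first by rewrite eq_mm' ltnn in lt_mm'.
have /orP[//|/dist_rank_lt] := closer_total a _ _ ne_mm'.
by move/(ltn_trans lt_mm'); rewrite ltnn.
Qed.

Lemma dist_rank_inj a : injective (dist_rank a).
Proof.
move=> m m' eq_r; apply/eqP; apply: contraT => /(closer_total a).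
by rewrite -!dist_rank_ltE eq_r ltnn.
Qed.

Lemma dist_rank_bound a m : (dist_rank a m < M)%N.
Proof.
rewrite -[X in (_ < X)%N]card_ord; apply: proper_card; apply/properP.
by split; [apply/fintype.subsetP | exists m; rewrite // inE; exact/negbT/closer_irr].
Qed.

(** Ties are also determined by strict comparisons. This allows distances to be replaced by
    alignments later on. *)
Lemma eq_dist_rank a b : (forall m m', (a m < a m') = (b m < b m')) ->
  dist_rank a =1 dist_rank b.
Proof.
move=> ab m; apply: eq_card => m' /=; rewrite !inE ab; congr (_ || (_ && _)).
by rewrite !eq_le !leNgt !ab.
Qed.

Lemma dist_rank_bij a : exists f : 'I_M -> 'I_M,
  bijective f /\ forall m, f m = dist_rank a m :> nat.
Proof.
pose f m := Ordinal (dist_rank_bound a m).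
exists f; split=> //.
by apply: injF_bij => m m' /(congr1 val) /= /dist_rank_inj.
Qed.

Lemma card_dist_rank_lt a k : (k <= M)%N ->
  #|[pred m | (dist_rank a m < k)%N]| = k.
Proof.
move=> kM; have [f [bf fE]] := dist_rank_bij a.
rewrite -sum1_card; under eq_bigl => m do rewrite inE -fE.
transitivity (\sum_(i < M | (i < k)%N) 1)%N; last first.
  by rewrite (big_ord_narrow kM) sum1_card card_ord.
by rewrite [RHS](reindex f)//; exact: onW_bij.
Qed.

Lemma ex_dist_rank a k : (k < M)%N -> exists m, dist_rank a m = k.
Proof.
move=> kM; have [f [[g gK fK] fE]] := dist_rank_bij a.
by exists (g (Ordinal kM)); rewrite -fE fK.
Qed.

(* ranks of [- a], so that [top_sum k a] is the sum of the [k] largest [a m] *)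
Definition top_rank a m := dist_rank (fun i => - a i) m.

Definition top_sum k a := \sum_(m | (top_rank a m < k)%N) a m.

Lemma top_rank_le a m m' : (top_rank a m <= top_rank a m')%N -> a m' <= a m.
Proof.
rewrite leq_eqVlt => /orP[/eqP/dist_rank_inj -> //|].
by rewrite dist_rank_ltE => /orP[|/andP[/eqP]]; lra.
Qed.

Lemma top_sum0 a : top_sum 0 a = 0.
Proof. by rewrite /top_sum big_pred0. Qed.

Lemma top_sumT a : top_sum M a = \sum_m a m.
Proof. by apply: eq_bigl => m; rewrite dist_rank_bound. Qed.

Lemma top_sumS k a m : top_rank a m = k -> top_sum k.+1 a = top_sum k a + a m.
Proof.
move=> mk; rewrite /top_sum (bigD1 m) /= ?mk ?ltnSn // addrC; congr (_ + _).
apply: eq_bigl => i; rewrite ltnS leq_eqVlt andb_orl.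
case: eqVneq => [ik|_] /=.
  have -> : i = m by apply: (@dist_rank_inj (fun i => - a i)); rewrite -/(top_rank a i) ik.
  by rewrite eqxx mk ltnn.
case: ltnP => //= ik; apply: contraTneq ik => ->.
by rewrite mk ltnn.
Qed.

(** At such a level the differences [a m - l] are nonnegative for the first [k] ranks and
    nonpositive for the others, so taking positive parts keeps exactly the first [k]. *)
Lemma sum_pos_part k a l : (k <= M)%N ->
  (forall m, (top_rank a m < k)%N -> l <= a m) ->
  (forall m, (k <= top_rank a m)%N -> a m <= l) ->
  \sum_m Num.max (a m - l) 0 = top_sum k a - k%:R * l.
Proof.
move=> kM lo hi; rewrite (bigID (fun m => (top_rank a m < k)%N)) /=.
rewrite [X in _ + X]big1 ?addr0; last first.
  by move=> m; rewrite -leqNgt => /hi am; apply/max_idPr; rewrite subr_le0.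
rewrite (eq_bigr (fun m => a m - l)); last first.
  by move=> m /lo am; apply/max_idPl; rewrite subr_ge0.
rewrite sumrB sumr_const /= mulr_natl; congr (_ - l *+ _).
exact: card_dist_rank_lt.
Qed.

(** Take the smallest of the [k] largest values as a level. On [S] the differences to it are at most
    their positive parts, whose sum over all indices is given by [sum_pos_part]; the same multiple
    of the level cancels on both sides. *)
Lemma top_sum_ge k a (S : {set 'I_M}) : #|S| = k -> \sum_(m in S) a m <= top_sum k a.
Proof.
move=> Sk; have kM : (k <= M)%N by rewrite -Sk -[leqRHS]card_ord max_card.
case: k => [|k] in Sk kM *.
  by rewrite top_sum0 big1 // => m; rewrite (cards0_eq Sk) inE.
have [i ik] := ex_dist_rank (fun i => - a i) _ kM.
have posE : \sum_m Num.max (a m - a i) 0 = top_sum k.+1 a - k.+1%:R * a i.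
  by apply: sum_pos_part => // m mk; apply: top_rank_le; [rewrite [leqRHS]ik | rewrite [leqLHS]ik ltnW].
rewrite -[leRHS](subrK (k.+1%:R * a i)) -posE.
rewrite -[leLHS](subrK (k.+1%:R * a i)) lerD2r mulr_natl -{1}Sk -sumr_const -sumrB.
rewrite [leRHS](bigID (mem S)) /=; apply: (@le_trans _ _ (\sum_(m in S) Num.max (a m - a i) 0)).
  by apply: ler_sum => m _; rewrite le_max lexx.
by rewrite lerDl sumr_ge0 // => m _; rewrite le_max lexx orbT.
Qed.

(** As ties are broken by index, [s] need not carry one top set to the other; only the cardinality
    of the image is used. *)
Lemma top_sum_perm_le k a (s : {perm 'I_M}) : (k <= M)%N ->
  top_sum k (fun m => a (s m)) <= top_sum k a.
Proof.
move=> kM; set b := fun m => a (s m).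
pose S := (s @: finset.finset (fun m => (top_rank b m < k)%N))%SET.
have -> : top_sum k b = \sum_(m in S) a m.
  rewrite big_imset /=; last by move=> x y _ _; exact: perm_inj.
  by under [RHS]eq_bigl => m do rewrite inE.
apply: top_sum_ge; rewrite card_imset; last exact: perm_inj.
by rewrite cardsE; exact: card_dist_rank_lt.
Qed.

Lemma top_sum_perm k a (s : {perm 'I_M}) : (k <= M)%N ->
  top_sum k (fun m => a (s m)) = top_sum k a.
Proof.
move=> kM; apply/eqP; rewrite eq_le top_sum_perm_le //=.
have := @top_sum_perm_le k (fun m => a (s m)) s^-1%g kM.
by under eq_fun do rewrite permKV.
Qed.

End Ranks.

(** * The linear program for a fixed codebook: gains, weights and thresholds *)

Section Thresholds.
Context {R : realType} {M : nat}.
Implicit Types (a p q : 'I_M -> R) (e l : R) (k : nat).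

(** For [e >= 1] this is $e y^+ - y^-$, the largest value of $s y$ over $1 \le s \le e$. *)
Definition gain e (y : R) : R := y + (e - 1) * Num.max y 0.

(** The normaliser $k e + M - k$ of [k]-closest encoding, in a form that shows its increment [e - 1]
    in [k]. *)
Definition kden e k : R := M%:R + k%:R * (e - 1).

Definition kweight e k a m : R :=
  (if (top_rank a m < k)%N then e else 1) / kden e k.

(* a point between the [k+1]-st and the [k]-th largest values of [a] *)
Definition threshold (x : R) k a : R :=
  x * (top_sum k a - top_sum k.-1 a) + (1 - x) * (top_sum k.+1 a - top_sum k a).

(* Weak duality for the linear program [max \sum_m a m * q m]
   under [p <= q <= e * p] and [\sum_m q m = 1]. *)
Lemma linprog_dual_bound a p q e l :
  (forall m, p m <= q m <= e * p m) -> \sum_m q m = 1 ->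
  \sum_m a m * q m <= l + \sum_m p m * gain e (a m - l).
Proof.
move=> pq q1; rewrite -[X in X + _]mulr1 -q1 mulr_sumr -big_split /=.
apply: ler_sum => m _; rewrite /gain; have /andP[h1 h2] := pq m.
rewrite -lerBlDl -mulrBl; set y := a m - l.
have [y0|y0] := leP y 0.
  by rewrite mulr0 addr0 [leRHS]mulrC ler_wnM2l.
rewrite (_ : _ + _ = y * e); last by ring.
by rewrite mulrCA ler_wpM2l ?(ltW y0) // mulrC.
Qed.

Lemma kden_gt0 e k : 1 < e -> (0 < M)%N -> 0 < kden e k.
Proof.
move=> e1 M0; have : 0 < M%:R :> R by rewrite ltr0n.
by move=> M0'; rewrite ltr_wpDr // mulr_ge0 // subr_ge0 ltW.
Qed.

(** The linear parts add up to [- M l] because the [a m] sum to zero, and the positive parts are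
    given by [sum_pos_part]. The two terms on the right have equal means once [l] has the score of
    [k] as its mean. *)
Lemma sum_gain e k a l : (k <= M)%N -> \sum_m a m = 0 ->
  (forall m, (top_rank a m < k)%N -> l <= a m) ->
  (forall m, (k <= top_rank a m)%N -> a m <= l) ->
  \sum_m gain e (a m - l) = (e - 1) * top_sum k a - l * kden e k.
Proof.
move=> kM a0 lo hi; rewrite big_split /= -mulr_sumr (sum_pos_part _ _ _ kM lo hi).
rewrite sumrB a0 sumr_const card_ord /kden -[l *+ M]mulr_natl; ring.
Qed.

Lemma sum_if_top_rank (x y : R) k a : (k <= M)%N ->
  \sum_m (if (top_rank a m < k)%N then x else y) = k%:R * x + (M%:R - k%:R) * y.
Proof.
move=> kM; rewrite (eq_bigr (fun m => y + (if (top_rank a m < k)%N then x - y else 0))).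
  rewrite big_split /= sumr_const card_ord -big_mkcond sumr_const /=.
  rewrite (_ : #|_| = k); last exact: card_dist_rank_lt.
  by rewrite -[y *+ M]mulr_natl -[(x - y) *+ k]mulr_natl; ring.
by move=> m _; case: ifP => _; lra.
Qed.

Lemma sum_kweight e k a : 1 < e -> (0 < M)%N -> (k <= M)%N ->
  \sum_m kweight e k a m = 1.
Proof.
move=> e1 M0 kM; rewrite -mulr_suml sum_if_top_rank //.
rewrite (_ : _ + _ = kden e k); last by rewrite /kden; ring.
by rewrite divff // gt_eqF // kden_gt0.
Qed.

Lemma sum_mul_kweight e k a : \sum_m a m = 0 ->
  \sum_m a m * kweight e k a m = (e - 1) / kden e k * top_sum k a.
Proof.
move=> a0; rewrite /kweight.
under eq_bigr do rewrite mulrA.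
rewrite -mulr_suml mulrAC; congr (_ / _).
rewrite (eq_bigr (fun m => a m + (if (top_rank a m < k)%N then (e - 1) * a m else 0))).
  by rewrite big_split /= a0 add0r -big_mkcond /= -mulr_sumr.
by move=> m _; case: ifP => _; ring.
Qed.

Lemma threshold_bounds x k a : 0 <= x <= 1 -> (0 < k < M)%N ->
  (forall m, (top_rank a m < k)%N -> threshold x k a <= a m) /\
  (forall m, (k <= top_rank a m)%N -> a m <= threshold x k a).
Proof.
move=> /andP[x0 x1] /andP[k0 kM].
(* Ranks start at 0, so [i] carries the [k+1]-st largest value and [j] the [k]-th. *)
have [i ik] := ex_dist_rank (fun i => - a i) _ kM.
have [j jk] : exists j, top_rank a j = k.-1.
  by apply: ex_dist_rank; rewrite (leq_ltn_trans (leq_pred _) kM).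
have -> : threshold x k a = x * a j + (1 - x) * a i.
  have := top_sumS _ _ _ jk; rewrite prednK // => Ej.
  rewrite /threshold (top_sumS _ _ _ ik); rewrite Ej; ring.
have aij : a i <= a j by apply: top_rank_le; rewrite jk [leqRHS]ik leq_pred.
split=> m mk.
  apply: (@le_trans _ _ (a j)); last by apply: top_rank_le; rewrite jk -ltnS (prednK k0).
  rewrite -subr_ge0 (_ : a j - _ = (1 - x) * (a j - a i)); last by ring.
  by rewrite mulr_ge0 ?subr_ge0.
apply: (@le_trans _ _ (a i)); first by apply: top_rank_le; rewrite [leqLHS]ik.
rewrite -subr_ge0 (_ : _ - _ = x * (a j - a i)); last by ring.
by rewrite mulr_ge0 ?subr_ge0.
Qed.

Lemma threshold_perm x k a (s : {perm 'I_M}) : (k < M)%N ->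
  threshold x k (fun m => a (s m)) = threshold x k a.
Proof.
move=> kM; have k1M : (k.-1 <= M)%N by exact: leq_trans (leq_pred _) (ltnW kM).
by rewrite /threshold !top_sum_perm // ltnW.
Qed.

(** A negative value is minus the sum of the others, each of which is at most the maximum. Hence the
    maximum cannot be small unless all values are. *)
Lemma normr_le_top_sum1 a i : \sum_m a m = 0 -> `|a i| <= M%:R * top_sum 1 a.
Proof.
move=> a0; have M0 : (0 < M)%N by apply: leq_ltn_trans (ltn_ord i).
have le_top m : a m <= top_sum 1 a.
  by have := top_sum_ge 1 a [set m]%SET (cards1 m); rewrite big_set1.
have top0 : 0 <= top_sum 1 a.
  rewrite -(pmulr_rge0 _ (_ : 0 < M%:R)) ?ltr0n // -a0 mulr_natl.
  by rewrite -[M in _ *+ M]card_ord -sumr_const; apply: ler_sum.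
have M1 : 1 <= M%:R :> R by rewrite ler1n.
rewrite ler_norml; apply/andP; split; last first.
  by apply: le_trans (le_top i) _; rewrite ler_peMl.
rewrite lerNl.
have -> : - a i = \sum_(m | m != i) a m.
  by move: a0; rewrite (bigD1 i) //= => /eqP; rewrite addrC addr_eq0 => /eqP ->.
apply: (@le_trans _ _ (\sum_(m | m != i) top_sum 1 a)); first exact: ler_sum.
rewrite mulr_natl -[M in _ *+ M]card_ord -sumr_const [leRHS](bigD1 i) //=.
by rewrite lerDr.
Qed.

Lemma ex_convex_comb (x c y : R) : x <= c <= y ->
  exists2 s : R, 0 <= s <= 1 & s * y + (1 - s) * x = c.
Proof.
move=> /andP[xc cy]; have [xy|xy] := eqVneq x y.
  by exists 0; rewrite ?lexx ?ler01 //; lra.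
have xy0 : 0 < y - x by rewrite subr_gt0 lt_neqAle xy (le_trans xc).
exists ((c - x) / (y - x)); last by field; rewrite gt_eqF.
by rewrite divr_ge0 ?ler_pdivrMr //=; lra.
Qed.

(** A maximiser over [0, ..., M] has a positive value, which excludes both ends. Being interior, it
    has two neighbours to be compared with. *)
Lemma ex_interior_argmax (f : nat -> R) : (1 < M)%N -> f 0%N = 0 -> f M = 0 -> 0 < f 1%N ->
  exists k, [/\ (0 < k < M)%N, 0 < f k & forall j, (j <= M)%N -> f j <= f k].
Proof.
move=> M1 f0 fM f1.
case: (@Order.TotalTheory.arg_maxP _ _ 'I_M.+1 ord0 xpredT (fun i => f i) isT) => k _ kmax.
have fk j : (j <= M)%N -> f j <= f k by rewrite -ltnS => jM; exact: (kmax (Ordinal jM)).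
have fk0 : 0 < f k by apply: lt_le_trans f1 (fk _ (ltnW M1)).
exists k; split=> //; rewrite lt0n ltn_neqAle -ltnS ltn_ord andbT.
by apply/andP; split; apply: contraTneq fk0 => ->; rewrite ?f0 ?fM ltxx.
Qed.

End Thresholds.

(** * Expectation of bounded random variables *)

Section BoundedRV.
Context {R : realType} {dm : measure_display} {T : measurableType dm}.
Implicit Types (f g : T -> R).

(** Such functions are integrable for every probability measure and, unlike integrable ones, closed
    under products. *)
Definition bmeas f := measurable_fun [set: T] f /\ exists K, forall t, `|f t| <= K.

Lemma bmeas_cst (c : R) : bmeas (fun=> c).
Proof. by split=> //; exists `|c|. Qed.

Lemma bmeasD f g : bmeas f -> bmeas g -> bmeas (fun t => f t + g t).
Proof.
move=> [mf [K fK]] [mg [L gL]]; split; first exact: measurable_funD.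
by exists (K + L) => t; apply: le_trans (ler_normD _ _) _; rewrite lerD.
Qed.

Lemma bmeasM f g : bmeas f -> bmeas g -> bmeas (fun t => f t * g t).
Proof.
move=> [mf [K fK]] [mg [L gL]]; split; first exact: measurable_funM.
by exists (K * L) => t; rewrite normrM ler_pM.
Qed.

Lemma bmeasZ c f : bmeas f -> bmeas (fun t => c * f t).
Proof. by apply: bmeasM; exact: bmeas_cst. Qed.

Lemma bmeasN f : bmeas f -> bmeas (fun t => - f t).
Proof. by move/(bmeasZ (-1)); under eq_fun do rewrite mulN1r. Qed.

Lemma bmeasB f g : bmeas f -> bmeas g -> bmeas (fun t => f t - g t).
Proof. by move=> bf /bmeasN; exact: bmeasD. Qed.

Lemma bmeas_norm f : bmeas f -> bmeas (fun t => `|f t|).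
Proof.
move=> [mf [K fK]]; split; first exact: measurableT_comp.
by exists K => t; rewrite normr_id.
Qed.

Lemma bmeas_max f g : bmeas f -> bmeas g -> bmeas (fun t => Num.max (f t) (g t)).
Proof.
move=> [mf [K fK]] [mg [L gL]]; split; first exact: measurable_maxr.
exists (K + L) => t; rewrite /Num.max /Order.max.
have := le_trans (normr_ge0 _) (fK t); have := le_trans (normr_ge0 _) (gL t).
by case: ifP => _ ? ?; [apply: le_trans (gL t) _ | apply: le_trans (fK t) _]; lra.
Qed.

Lemma bmeas_sum (I : Type) (s : seq I) (p : pred I) (h : I -> T -> R) :
  (forall i, bmeas (h i)) -> bmeas (fun t => \sum_(i <- s | p i) h i t).
Proof.
move=> bh; elim: s => [|i s IH].
  by under eq_fun do rewrite big_nil; exact: bmeas_cst.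
under eq_fun do rewrite big_cons; case: (p i) => //; exact: bmeasD.
Qed.

Variable P : probability T R.

Lemma bmeas_integrable f : bmeas f -> P.-integrable [set: T] (EFin \o f).
Proof.
move=> [mf [K fK]]; apply: measurable_bounded_integrable => //.
  exact: (le_lt_trans (probability_le1 P measurableT) (ltry _)).
exists K; split; first exact: num_real.
by move=> x Kx t _; exact: le_trans (fK t) (ltW Kx).
Qed.

Definition EX f := \int[P]_t f t.

Lemma integral_EX f : bmeas f -> (\int[P]_t (f t)%:E)%E = (EX f)%:E.
Proof. by move=> bf; rewrite fineK //; apply: integrable_fin_num (bmeas_integrable _ bf). Qed.

Lemma EX_cst c : EX (fun=> c) = c.
Proof.
rewrite /EX Rintegral_cst // -[RHS]mulr1; congr (c * _).
exact: (congr1 fine (probability_setT P)).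
Qed.

Lemma EXD f g : bmeas f -> bmeas g -> EX (fun t => f t + g t) = EX f + EX g.
Proof. by move=> bf bg; rewrite /EX RintegralD //; exact: bmeas_integrable. Qed.

Lemma EXZ c f : bmeas f -> EX (fun t => c * f t) = c * EX f.
Proof. by move=> bf; rewrite /EX RintegralZl //; exact: bmeas_integrable. Qed.

Lemma EXB f g : bmeas f -> bmeas g -> EX (fun t => f t - g t) = EX f - EX g.
Proof. by move=> bf bg; rewrite /EX RintegralB //; exact: bmeas_integrable. Qed.

Lemma eq_EX f g : f =1 g -> EX f = EX g.
Proof. by move=> fg; apply: eq_Rintegral => t _. Qed.

Lemma EX_sum (I : Type) (s : seq I) (p : pred I) (h : I -> T -> R) :
  (forall i, bmeas (h i)) ->
  EX (fun t => \sum_(i <- s | p i) h i t) = \sum_(i <- s | p i) EX (h i).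
Proof.
move=> bh; elim: s => [|i s IH].
  by rewrite big_nil; under eq_EX do rewrite big_nil; rewrite EX_cst.
rewrite big_cons; under eq_EX do rewrite big_cons; case: (p i) => //.
by rewrite EXD // ?IH //; exact: bmeas_sum.
Qed.

Lemma EX_ge0_ae f : bmeas f -> {ae P, forall t, 0 <= f t} -> 0 <= EX f.
Proof.
move=> bf f0; have bm := bmeas_max _ _ bf (bmeas_cst 0).
rewrite /EX /Rintegral (ae_eq_integral (fun t => (Num.max (f t) 0)%:E)) //.
- by apply: fine_ge0; apply: integral_ge0 => t _; rewrite lee_fin le_max lexx orbT.
- by apply/measurable_EFinP; case: bf.
- by apply/measurable_EFinP; case: bm.
by apply: filterS f0 => t ft _; congr EFin; apply/esym/max_idPl.
Qed.

Lemma le_EX_ae f g : bmeas f -> bmeas g -> {ae P, forall t, f t <= g t} -> EX f <= EX g.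
Proof.
move=> bf bg fg; rewrite -subr_ge0 -EXB //; apply: EX_ge0_ae; first exact: bmeasB.
by apply: filterS fg => t; rewrite subr_ge0.
Qed.

Lemma le_EX f g : bmeas f -> bmeas g -> (forall t, f t <= g t) -> EX f <= EX g.
Proof. by move=> bf bg fg; apply: le_EX_ae => //; exact: aeW. Qed.

Lemma normr_EX_le f K : bmeas f -> (forall t, `|f t| <= K) -> `|EX f| <= K.
Proof.
move=> bf fK; have fK2 t : - K <= f t <= K by rewrite -ler_norml.
rewrite ler_norml; apply/andP; split.
  rewrite -[leLHS]EX_cst; apply: le_EX => // [|t]; first exact: bmeas_cst.
  by have /andP[] := fK2 t.
rewrite -[leRHS]EX_cst; apply: le_EX => // [|t]; first exact: bmeas_cst.
by have /andP[] := fK2 t.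
Qed.

(** The first moment method, used to replace a random point by a fixed one. *)
Lemma EX_exists_le f c : bmeas f -> EX f < c -> exists t, f t <= c.
Proof.
move=> bf fc; apply: contrapT => /forallNP nf.
suff : c <= EX f by rewrite leNgt fc.
rewrite -(EX_cst c); apply: le_EX => // [|t]; first exact: bmeas_cst.
by rewrite leNgt; apply/negP => /ltW; exact: nf.
Qed.

End BoundedRV.

(** * Exchange of two independent expectations *)

Section Fubini.
Context {R : realType} {dm : measure_display} {T : measurableType dm}.
Variable P : probability T R.
Variable F : T * T -> R.
Hypothesis bF : bmeas F.

Let intF : (P \x P)%E.-integrable [set: T * T] (EFin \o F).
Proof.
have [mF [K FK]] := bF; apply: measurable_bounded_integrable => //.
  rewrite -setXTT; have := @product_measure1E _ _ T T R P P _ _ measurableT measurableT.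
  move=> /(congr1 (fun x => x < +oo)%E) ->.
  apply: (@le_lt_trans _ _ (1 * 1)%E); last by rewrite mule1 ltry.
  by apply: lee_pmul => //; exact: probability_le1.
exists K; split; first exact: num_real.
by move=> x Kx t _; exact: le_trans (FK t) (ltW Kx).
Qed.

Lemma bmeas_fst t' : bmeas (fun t => F (t, t')).
Proof.
have [mF [K FK]] := bF; split; last by exists K.
exact: measurable_fun_pair1.
Qed.

Lemma bmeas_snd t : bmeas (fun t' => F (t, t')).
Proof.
have [mF [K FK]] := bF; split; last by exists K.
exact: measurable_fun_pair2.
Qed.

Lemma bmeas_EX_snd : bmeas (fun t => EX P (fun t' => F (t, t'))).
Proof.
split; last first.
  have [_ [K FK]] := bF; exists K => t.
  by apply: normr_EX_le => //; exact: bmeas_snd.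
apply/measurable_EFinP; have := measurable_fubini_F intF.
by congr measurable_fun; apply/funext => t /=; rewrite -integral_EX //; exact: bmeas_snd.
Qed.

Lemma bmeas_EX_fst : bmeas (fun t' => EX P (fun t => F (t, t'))).
Proof.
split; last first.
  have [_ [K FK]] := bF; exists K => t.
  by apply: normr_EX_le => //; exact: bmeas_fst.
apply/measurable_EFinP; have := measurable_fubini_G intF.
by congr measurable_fun; apply/funext => t /=; rewrite -integral_EX //; exact: bmeas_fst.
Qed.

Lemma EX_swap : EX P (fun t => EX P (fun t' => F (t, t'))) =
  EX P (fun t' => EX P (fun t => F (t, t'))).
Proof.
apply: EFin_inj; rewrite -!integral_EX; [|exact: bmeas_EX_fst|exact: bmeas_EX_snd].
transitivity (\int[P]_t \int[P]_t' (F (t, t'))%:E)%E.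
  by apply: eq_integral => t _; rewrite integral_EX //; exact: bmeas_snd.
rewrite (Fubini intF); apply: eq_integral => t _.
by rewrite -integral_EX //; exact: bmeas_fst.
Qed.

End Fubini.

(** * Orthogonal matrices and the simplex *)

Section Orthogonal.
Context {R : realType} {n : nat}.
Implicit Types (x y v w : 'cV[R]_n) (A B : 'M[R]_n).

Definition dot x y : R := \sum_j x j 0 * y j 0.

Lemma dotE x y : dot x y = (x^T *m y) 0 0.
Proof. by rewrite mxE; apply: eq_bigr => j _; rewrite mxE. Qed.

Lemma dotC x y : dot x y = dot y x.
Proof. by apply: eq_bigr => j _; rewrite mulrC. Qed.

Lemma dotDr x y w : dot x (y + w) = dot x y + dot x w.
Proof. by rewrite !dotE mulmxDr mxE. Qed.

Lemma dotZr x c y : dot x (c *: y) = c * dot x y.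
Proof. by rewrite !dotE -scalemxAr mxE. Qed.

Lemma dotNr x y : dot x (- y) = - dot x y.
Proof. by rewrite !dotE mulmxN mxE. Qed.

Lemma dot_trmx A x y : dot (A^T *m x) y = dot x (A *m y).
Proof. by rewrite !dotE trmx_mul trmxK mulmxA. Qed.

Lemma sqnormE x : sqnorm x = dot x x.
Proof. by apply: eq_bigr => j _; rewrite expr2. Qed.

Lemma sqnormB x y : sqnorm (x - y) = sqnorm x + sqnorm y - 2 * dot x y.
Proof.
rewrite !sqnormE dotDr dotNr dotC [dot (x - y) y]dotC !dotDr !dotNr [dot y x]dotC; ring.
Qed.

Lemma sqnorm_ge0 x : 0 <= sqnorm x.
Proof. by apply: sumr_ge0 => j _; rewrite sqr_ge0. Qed.

Lemma sqnorm_eq0 x : sqnorm x = 0 -> x = 0.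
Proof.
move=> /eqP; rewrite psumr_eq0 => [/allP x0|j _]; last exact: sqr_ge0.
apply/colP => j; have := x0 j (mem_index_enum _).
by rewrite mxE sqrf_eq0 => /eqP.
Qed.

Lemma dot_le1 x y : sqnorm x = 1 -> sqnorm y = 1 -> `|dot x y| <= 1.
Proof.
move=> x1 y1; have := sqnorm_ge0 (x - y); have := sqnorm_ge0 (x - - y).
rewrite !sqnormB dotNr x1 (_ : sqnorm (- y) = sqnorm y) ?y1.
  by move=> ? ?; rewrite ler_norml; apply/andP; split; lra.
by rewrite !sqnormE dotNr dotC dotNr opprK.
Qed.

Lemma orthogonal_trmx A : orthogonal_mx A -> orthogonal_mx A^T.
Proof. by rewrite /orthogonal_mx trmxK => /mulmx1C. Qed.

Lemma orthogonal_mul A B : orthogonal_mx A -> orthogonal_mx B -> orthogonal_mx (A *m B).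
Proof. by rewrite /orthogonal_mx => oA oB; rewrite trmx_mul mulmxA -(mulmxA B^T) oA mulmx1. Qed.

Lemma dot_orthogonal A x y : orthogonal_mx A -> dot (A *m x) (A *m y) = dot x y.
Proof. by move=> oA; rewrite -dot_trmx mulmxA oA mul1mx. Qed.

Lemma sqnorm_orthogonal A x : orthogonal_mx A -> sqnorm (A *m x) = sqnorm x.
Proof. by move=> oA; rewrite !sqnormE dot_orthogonal. Qed.

(** The Householder reflection along [v] when [c * sqnorm v = 2]; keeping [c] free avoids
    normalising [v]. *)
Definition reflection_mx (c : R) v : 'M[R]_n := 1%:M - c *: (v *m v^T).

Lemma reflection_mxE c v x : reflection_mx c v *m x = x - (c * dot v x) *: v.
Proof.
rewrite mulmxBl mul1mx -scalemxAl -mulmxA [v^T *m x]mx11_scalar -dotE.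
by rewrite mul_mx_scalar scalerA.
Qed.

Lemma reflection_mx_orthogonal c v : c * sqnorm v = 2 -> orthogonal_mx (reflection_mx c v).
Proof.
move=> cv; have sym : (reflection_mx c v)^T = reflection_mx c v.
  by rewrite /reflection_mx linearB /= linearZ /= trmx_mul trmxK tr_scalar_mx.
rewrite /orthogonal_mx sym {2}/reflection_mx mulmxBr mulmx1 -scalemxAr mulmxA.
rewrite reflection_mxE -sqnormE cv.
rewrite (_ : v - 2 *: v = - v); last by rewrite scaler_nat mulr2n opprD addNKr.
by rewrite mulNmx scalerN opprK /reflection_mx subrK.
Qed.

(** The reflection along [x - y] exchanges [x] and [y]: as both have norm 1, the squared norm of
    [x - y] is twice its inner product with [x]. *)
Lemma orthogonal_transitive x y : sqnorm x = 1 -> sqnorm y = 1 ->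
  exists2 B, orthogonal_mx B & B *m x = y.
Proof.
move=> x1 y1; have [->|xy] := eqVneq x y.
  by exists 1%:M; rewrite /orthogonal_mx ?trmx1 mul1mx.
have n0 : sqnorm (x - y) != 0.
  by apply: contra_neq xy => /sqnorm_eq0 /eqP; rewrite subr_eq0 => /eqP.
exists (reflection_mx (2 / sqnorm (x - y)) (x - y)).
  by apply: reflection_mx_orthogonal; rewrite mulfVK.
rewrite reflection_mxE (_ : _ * _ = 1) ?scale1r ?subKr //.
have nE : sqnorm (x - y) = 2 * dot (x - y) x.
  by rewrite sqnormB [dot (x - y) x]dotC dotDr dotNr -sqnormE x1 y1; ring.
have d0 : dot (x - y) x != 0 by apply: contra_neq n0 => d0; rewrite nE d0 mulr0.
by rewrite nE; field.
Qed.

End Orthogonal.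

(** * The simplex vectors and their symmetries *)

Section Simplex.
Context {R : realType} {d M : nat}.
Hypotheses (M_gt1 : (1 < M)%N) (le_Md : (M <= d)%N).
Implicit Types (w : 'cV[R]_d) (m : 'I_M).

(** The alignment with the [m]-th simplex vector. At [w = A^T v] it is $\langle A s_m, v\rangle$, so
    that a rotation of the codebook becomes a rotation of the input. *)
Definition simplex_coord w m : R := dot (simplex_vec R d m) w.

Let S : R := Num.sqrt (M%:R * (M%:R - 1)).

Let M1_gt0 : 0 < M%:R - 1 :> R.
Proof. by rewrite subr_gt0 ltr1n. Qed.

Let M_gt0 : 0 < M%:R :> R.
Proof. by rewrite ltr0n ltnW. Qed.

Let S_sqr : S ^+ 2 = M%:R * (M%:R - 1).
Proof. by rewrite sqr_sqrtr // mulr_ge0 // ltW. Qed.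

Lemma sum_ord_narrow (F : nat -> R) :
  \sum_(j < d) (if (j < M)%N then F j else 0) = \sum_(j < M) F j.
Proof. by rewrite -big_mkcond (big_ord_narrow le_Md). Qed.

Lemma sqnorm_simplex_vec m : sqnorm (simplex_vec R d m : 'cV[R]_d) = 1.
Proof.
rewrite /sqnorm.
pose F (j : nat) : R := (- 1 / S) ^+ 2 + (if j == m then ((M%:R - 1) / S) ^+ 2 - (- 1 / S) ^+ 2 else 0).
rewrite (eq_bigr (fun j : 'I_d => if (j < M)%N then F j else 0)); last first.
  by move=> j _; rewrite mxE /F -/S; case: ifP => _; [case: ifP => _; ring | rewrite expr0n].
rewrite sum_ord_narrow /F big_split /= sumr_const card_ord -[(- 1 / S) ^+ 2 *+ M]mulr_natl.
rewrite -big_mkcond /= (big_pred1 m) // !expr_div_n sqrrN S_sqr; field.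
by rewrite !gt_eqF.
Qed.

Lemma sum_simplex_vec (j : 'I_d) : \sum_(m < M) simplex_vec R d m j 0 = 0 :> R.
Proof.
have [jM|jM] := boolP (j < M)%N; last first.
  by rewrite big1 // => m _; rewrite mxE (negPf jM).
rewrite (eq_bigr (fun m => - 1 / S + (if m == Ordinal jM then (M%:R - 1) / S - (- 1 / S) else 0))).
  by rewrite big_split /= sumr_const card_ord -big_mkcond /= big_pred1_eq -[(- 1 / S) *+ M]mulr_natl; ring.
move=> m _; rewrite mxE jM -val_eqE /= eq_sym -/S; case: ifP => _; ring.
Qed.

Lemma sum_simplex_coord w : \sum_(m < M) simplex_coord w m = 0.
Proof.
rewrite exchange_big /= big1 // => j _.
by rewrite -mulr_suml sum_simplex_vec mul0r.
Qed.

Lemma simplex_coord_le1 w m : sqnorm w = 1 -> `|simplex_coord w m| <= 1.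
Proof. by apply: dot_le1; exact: sqnorm_simplex_vec. Qed.

(** Exchanging two of the first [M] coordinates of the space exchanges the two corresponding simplex
    vectors and fixes the others. Under the Haar law this makes the alignments exchangeable. *)
Lemma simplex_coord_tperm m1 m2 : exists2 B : 'M[R]_d, orthogonal_mx B &
  forall w, simplex_coord (B *m w) = (fun m : 'I_M => simplex_coord w (tperm m1 m2 m)).
Proof.
pose s := tperm (widen_ord le_Md m1) (widen_ord le_Md m2).
have sK j : s (s j) = j by rewrite /s tpermK.
exists (perm_mx s); first by rewrite /orthogonal_mx tr_perm_mx -perm_mxM mulVg perm_mx1.
move=> w; apply/funext => m; rewrite /simplex_coord /dot (reindex_inj (@perm_inj _ s)).
apply: eq_bigr => j _; rewrite -row_permE [row_perm _ _ _ _]mxE sK; congr (_ * _).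
have sW i : s (widen_ord le_Md i) = widen_ord le_Md (tperm m1 m2 i).
  rewrite /s !permE /= -!val_eqE /=.
  by case: (_ == _ :> nat) => //; case: (_ == _ :> nat).
have sjM : (s j < M)%N = (j < M)%N.
  apply/idP/idP => jM.
    have := sW (Ordinal jM); rewrite (_ : widen_ord le_Md (Ordinal jM) = s j); last exact: val_inj.
    by rewrite sK => ->; exact: (ltn_ord (tperm m1 m2 (Ordinal jM))).
  have := sW (Ordinal jM); rewrite (_ : widen_ord le_Md (Ordinal jM) = j); last exact: val_inj.
  by move=> ->; exact: (ltn_ord (tperm m1 m2 (Ordinal jM))).
rewrite !mxE sjM; case: ifP => // jM; congr (if _ then _ else _).
transitivity (s j == widen_ord le_Md m); first by rewrite -val_eqE.
by rewrite -(inj_eq (@perm_inj _ s)) sK sW -val_eqE.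
Qed.

End Simplex.

(** * Haar-distributed matrices *)

(** The generators of the sigma-algebra behind [mx_measurable], named so that matrices form a
    measurable type and [A] has a law on it. *)
Definition mx_coordinates (R : realType) (n : nat) : set (set 'M[R]_n) :=
  \big[setU/set0]_(i < n * n)
    preimage_set_system setT (fun X : 'M[R]_n => mxvec X 0 i) measurable.

Notation mx_space R n := (g_sigma_algebraType (mx_coordinates R n)).

Section MatrixMeasurable.
Import numFieldNormedType.Exports.
Context {R : realType} {n : nat}.

Lemma measurable_mx_entry i j :
  measurable_fun [set: mx_space R n] (fun X : mx_space R n => (X : 'M[R]_n) i j).
Proof.
move=> _ Y mY; rewrite setTI; apply: sub_sigma_algebra.
rewrite /mx_coordinates (bigD1 (mxvec_index i j)) //=; left.
by exists Y => //; rewrite setTI; apply/funext => X /=; rewrite mxvecE.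
Qed.

Lemma measurable_to_mx {dm : measure_display} {T : measurableType dm} (f : T -> 'M[R]_n) :
  (forall i j, measurable_fun [set: T] (fun t => f t i j)) ->
  measurable_fun [set: T] (f : T -> mx_space R n).
Proof.
move=> mf; apply: (@measurability _ _ T (mx_space R n) setT f (mx_coordinates R n)) => //.
move=> _ [B + <-]; rewrite /mx_coordinates => mB.
suff : forall i, preimage_set_system setT (fun X : 'M[R]_n => mxvec X 0 i) measurable B ->
    measurable (f @^-1` B).
  rewrite setTI => mi; move: mB; elim/big_rec: _ => // i A _ IH [/mi//|]; exact: IH.
move=> k [Y mY <-]; case/mxvec_indexP: k => i j.
have := mf i j measurableT Y mY; rewrite !setTI; congr measurable.
by apply/funext => t /=; rewrite mxvecE.
Qed.

End MatrixMeasurable.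

Lemma measurable_mulmx_entry {R : realType} {d' : measure_display} {T' : measurableType d'}
    (p q r : nat) (X : T' -> 'M[R]_(p, q)) (Y : T' -> 'M[R]_(q, r)) i j :
  (forall i j, measurable_fun [set: T'] (fun t => X t i j)) ->
  (forall i j, measurable_fun [set: T'] (fun t => Y t i j)) ->
  measurable_fun [set: T'] (fun t => (X t *m Y t) i j).
Proof.
move=> mX mY; under eq_fun do rewrite mxE.
by apply: measurable_sum => k; exact: measurable_funM.
Qed.

Section Haar.
Import numFieldNormedType.Exports.
Context {R : realType} {dm : measure_display} {T : measurableType dm}.
Variables (P : probability T R) (n : nat) (A : T -> 'M[R]_n).
Hypothesis haarA : haar_random_orthogonal P A.

Let orthA t : orthogonal_mx (A t). Proof. by case: haarA. Qed.

Let measA i j : measurable_fun [set: T] (fun t => A t i j). Proof. by case: haarA. Qed.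

(** Both sides are integrals of [h] against pushforwards of [P], and the two pushforwards agree on
    measurable sets by the Haar property. Only the values of [h] on orthogonal matrices enter, so a
    bound there suffices. *)
Lemma haar_EX_invariant (h : 'M[R]_n -> R) (Q : 'M[R]_n) :
  measurable_fun [set: mx_space R n] (h : mx_space R n -> R) ->
  (exists K, forall X, orthogonal_mx X -> `|h X| <= K) -> orthogonal_mx Q ->
  EX P (fun t => h (Q *m A t)) = EX P (fun t => h (A t)).
Proof.
move=> mh [K hK] oQ.
have mA : measurable_fun [set: T] (A : T -> mx_space R n) by exact: measurable_to_mx.
have mQA : measurable_fun [set: T] ((fun t => Q *m A t) : T -> mx_space R n).
  by apply: measurable_to_mx => i j; exact: measurable_mulmx_entry.
have bA : bmeas (fun t => h (A t)).
  by split; [exact: (measurableT_comp mh mA) | exists K => t; exact: hK].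
have bQA : bmeas (fun t => h (Q *m A t)).
  split; first exact: (measurableT_comp mh mQA).
  by exists K => t; apply/hK/orthogonal_mul.
rewrite /EX /Rintegral; congr fine.
have mhE : measurable_fun [set: mx_space R n] (EFin \o (h : mx_space R n -> R)) by exact/measurable_EFinP.
have := integral_pushforward mA mhE (bmeas_integrable P _ bA) measurableT.
have := integral_pushforward mQA mhE (bmeas_integrable P _ bQA) measurableT.
rewrite !preimage_setT /= => <- <-; apply: eq_measure_integral => B mB _ /=.
by case: haarA => _ _ inv; exact/esym/(inv Q oQ B mB).
Qed.

End Haar.

(** * Measurable bounded functionals of the alignments *)

Section BoundedFunctionals.
Context {R : realType} {M : nat}.
Implicit Types (H : ('I_M -> R) -> R).

(** The quantification over all measurable spaces lets one fact serve for [T], for [T * T] and for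
    the space of matrices. *)
Definition bfunctional H := forall (dm : measure_display) (T : measurableType dm)
  (a : T -> 'I_M -> R), (forall m, bmeas (fun t => a t m)) -> bmeas (fun t => H (a t)).

Lemma bmeas_if {dm : measure_display} {T : measurableType dm} (b : T -> bool) (f g : T -> R) :
  measurable_fun [set: T] b -> bmeas f -> bmeas g -> bmeas (fun t => if b t then f t else g t).
Proof.
move=> mb [mf [K fK]] [mg [L gL]]; split; first exact: measurable_fun_ifT.
exists (Num.max K L) => t; rewrite le_max; case: ifP => _; first by rewrite fK.
by rewrite gL orbT.
Qed.

(** The rank is a finite sum of indicators of comparisons between entries. *)
Lemma measurable_top_rank_lt {dm : measure_display} {T : measurableType dm}
    (a : T -> 'I_M -> R) m k : (forall m, measurable_fun [set: T] (fun t => a t m)) ->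
  measurable_fun [set: T] (fun t => (top_rank (a t) m < k)%N).
Proof.
move=> ma.
under eq_fun => t.
  rewrite /top_rank dist_rankE -(ltr_nat R) -sum1_card natr_sum big_mkcond.
  over.
apply: measurable_fun_ltr => //; apply: measurable_sum => m'.
apply: measurable_fun_ifT => //.
have mN i : measurable_fun [set: T] (fun t => - a t i) by exact: measurableT_comp.
apply: measurable_or; first exact: measurable_fun_ltr.
by apply: measurable_and => //; exact: measurable_fun_eqr.
Qed.

Lemma bfunctional_if_top_rank m k (H1 H2 : ('I_M -> R) -> R) :
  bfunctional H1 -> bfunctional H2 ->
  bfunctional (fun a => if (top_rank a m < k)%N then H1 a else H2 a).
Proof.
move=> b1 b2 dm T a ba; apply: bmeas_if; [|exact: b1|exact: b2].
by apply: measurable_top_rank_lt => i; case: (ba i).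
Qed.

Lemma bfunctional_top_sum k : bfunctional (top_sum k).
Proof.
move=> dm T a ba; rewrite /top_sum.
under eq_fun do rewrite big_mkcond.
apply: bmeas_sum => m; apply: bmeas_if => //; last exact: bmeas_cst.
by apply: measurable_top_rank_lt => i; case: (ba i).
Qed.

Lemma bfunctional_threshold x k : bfunctional (threshold x k).
Proof.
move=> dm T a ba; apply: bmeasD; apply: bmeasZ; apply: bmeasB; exact: bfunctional_top_sum.
Qed.

Lemma bfunctional_gain e x k m :
  bfunctional (fun a => gain e (a m - threshold x k a)).
Proof.
move=> dm T a ba; have b : bmeas (fun t => a t m - threshold x k (a t)).
  by apply: bmeasB => //; exact: bfunctional_threshold.
by apply: bmeasD => //; apply: bmeasZ; apply: bmeas_max => //; exact: bmeas_cst.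
Qed.

Lemma bfunctional_kweight e k m : bfunctional (fun a => kweight e k a m).
Proof.
move=> dm T a ba; under eq_fun do rewrite /kweight mulrC.
apply: bmeasZ; apply: (bfunctional_if_top_rank m k (fun=> e) (fun=> 1) _ _ dm T a ba);
  by move=> *; exact: bmeas_cst.
Qed.

(* Clipping keeps functions of the entries bounded off the orthogonal group. *)
Definition clip (x : R) : R := Num.max (-1) (- Num.max (-1) (- x)).

Lemma clip_le1 x : `|clip x| <= 1.
Proof.
rewrite ler_norml /clip le_max lexx /= ge_max [X in _ && X]lerNl le_max lexx andbT.
by lra.
Qed.

Lemma clip_id x : `|x| <= 1 -> clip x = x.
Proof.
rewrite ler_norml => /andP[x1 x2]; rewrite /clip (_ : Num.max (-1) (- x) = - x).
  by rewrite opprK; apply/max_idPr.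
by apply/max_idPr; rewrite lerN2.
Qed.

Lemma bmeas_clip {dm : measure_display} {T : measurableType dm} (f : T -> R) :
  measurable_fun [set: T] f -> bmeas (fun t => clip (f t)).
Proof.
move=> mf; split; last by exists 1 => t; exact: clip_le1.
apply: measurable_maxr => //; apply: measurableT_comp => //.
by apply: measurable_maxr => //; exact: measurableT_comp.
Qed.

End BoundedFunctionals.

(** * The law of the alignments under the Haar measure *)

Section Law.
Import numFieldNormedType.Exports.
Context {R : realType} {dm : measure_display} {T : measurableType dm}.
Variables (P : probability T R) (d M : nat) (A : T -> 'M[R]_d).
Hypothesis haarA : haar_random_orthogonal P A.
Hypotheses (M_gt1 : (1 < M)%N) (le_Md : (M <= d)%N).
Implicit Types (v w x : 'cV[R]_d) (H : ('I_M -> R) -> R) (Q : 'M[R]_d).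

Lemma haar_orthogonal t : orthogonal_mx (A t). Proof. by case: haarA. Qed.

Lemma haar_measurable i j : measurable_fun [set: T] (fun t => A t i j).
Proof. by case: haarA. Qed.

Lemma measurable_dot {dm' : measure_display} {T' : measurableType dm'} x (w : T' -> 'cV[R]_d) :
  (forall j, measurable_fun [set: T'] (fun t => w t j 0)) ->
  measurable_fun [set: T'] (fun t => dot x (w t)).
Proof. by move=> mw; apply: measurable_sum => j; exact: measurable_funM. Qed.

Lemma bmeas_simplex_coord {dm' : measure_display} {T' : measurableType dm'} H (w : T' -> 'cV[R]_d) :
  bfunctional H -> (forall j, measurable_fun [set: T'] (fun t => w t j 0)) ->
  (forall t, sqnorm (w t) = 1) -> bmeas (fun t => H (simplex_coord (w t))).
Proof.
move=> bH mw w1; apply: bH => m; split; first exact: measurable_dot.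
by exists 1 => t; exact: simplex_coord_le1.
Qed.

Lemma bmeas_haar H v : bfunctional H -> sqnorm v = 1 -> bmeas (fun t => H (simplex_coord (A t *m v))).
Proof.
move=> bH v1; apply: bmeas_simplex_coord => // [j|t]; last by rewrite sqnorm_orthogonal //; exact: haar_orthogonal.
by apply: measurable_mulmx_entry => // ? ?; exact: haar_measurable.
Qed.

Lemma bmeas_haar_tr H v : bfunctional H -> sqnorm v = 1 ->
  bmeas (fun t => H (simplex_coord ((A t)^T *m v))).
Proof.
move=> bH v1; apply: bmeas_simplex_coord => // [j|t].
  apply: measurable_mulmx_entry => // i k; under eq_fun do rewrite mxE.
  exact: haar_measurable.
by rewrite sqnorm_orthogonal //; apply: orthogonal_trmx; exact: haar_orthogonal.
Qed.

Lemma bmeas_haar_pair H v : bfunctional H -> sqnorm v = 1 ->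
  bmeas (fun p : T * T => H (simplex_coord ((A p.1)^T *m (A p.2 *m v)))).
Proof.
move=> bH v1; apply: bmeas_simplex_coord => // [j|t].
  apply: measurable_mulmx_entry => // [i k|i k].
    under eq_fun do rewrite mxE.
    exact: (measurableT_comp (haar_measurable k i) measurable_fst).
  apply: measurable_mulmx_entry => // i' k'.
  exact: (measurableT_comp (haar_measurable i' k') measurable_snd).
rewrite !sqnorm_orthogonal //; first exact: haar_orthogonal.
by apply: orthogonal_trmx; exact: haar_orthogonal.
Qed.

Lemma EX_haar_left H v Q : bfunctional H -> sqnorm v = 1 -> orthogonal_mx Q ->
  EX P (fun t => H (simplex_coord (Q *m (A t *m v)))) = EX P (fun t => H (simplex_coord (A t *m v))).
Proof.
move=> bH v1 oQ; pose h (X : 'M[R]_d) := H (fun m => clip (simplex_coord (X *m v) m)).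
have hE X : orthogonal_mx X -> h X = H (simplex_coord (X *m v)).
  move=> oX; congr H; apply/funext => m; rewrite clip_id //.
  by apply: simplex_coord_le1 => //; rewrite sqnorm_orthogonal.
have [mh [K hK]] : bmeas (h : mx_space R d -> R).
  apply: bH => m; apply: bmeas_clip; apply: measurable_dot => j.
  by apply: measurable_mulmx_entry => // *; exact: measurable_mx_entry.
rewrite (eq_EX P _ (fun t => h (Q *m A t))); last first.
  by move=> t; rewrite hE ?mulmxA //; apply: orthogonal_mul => //; exact: haar_orthogonal.
rewrite (haar_EX_invariant _ _ _ haarA _ _ mh) //; last by exists K.
by apply: eq_EX => t; rewrite hE //; exact: haar_orthogonal.
Qed.

(** Since [A^T Q v = (Q^T A)^T v], this is again left invariance of the law of [A]. *)
Lemma EX_haar_tr_right H v Q : bfunctional H -> sqnorm v = 1 -> orthogonal_mx Q ->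
  EX P (fun t => H (simplex_coord ((A t)^T *m (Q *m v)))) = EX P (fun t => H (simplex_coord ((A t)^T *m v))).
Proof.
move=> bH v1 oQ; pose h (X : 'M[R]_d) := H (fun m => clip (simplex_coord (X^T *m v) m)).
have hE X : orthogonal_mx X -> h X = H (simplex_coord (X^T *m v)).
  move=> oX; congr H; apply/funext => m; rewrite clip_id //.
  by apply: simplex_coord_le1 => //; rewrite sqnorm_orthogonal //; exact: orthogonal_trmx.
have [mh [K hK]] : bmeas (h : mx_space R d -> R).
  apply: bH => m; apply: bmeas_clip; apply: measurable_dot => j.
  apply: measurable_mulmx_entry => // *; under eq_fun do rewrite mxE.
  exact: measurable_mx_entry.
have oQ' := orthogonal_trmx _ oQ.
rewrite (eq_EX P _ (fun t => h (Q^T *m A t))); last first.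
  move=> t; rewrite hE ?trmx_mul ?trmxK ?mulmxA //.
  by apply: orthogonal_mul => //; exact: haar_orthogonal.
rewrite (haar_EX_invariant _ _ _ haarA _ _ mh) //; last by exists K.
by apply: eq_EX => t; rewrite hE //; exact: haar_orthogonal.
Qed.

(* Both sides equal the expectation of [H (simplex_coord (A^T A' w))]
   for an independent copy [A'] of [A]. *)
Lemma EX_haar_tr H v w : bfunctional H -> sqnorm v = 1 -> sqnorm w = 1 ->
  EX P (fun t => H (simplex_coord ((A t)^T *m v))) = EX P (fun t => H (simplex_coord (A t *m w))).
Proof.
move=> bH v1 w1; have bF := bmeas_haar_pair H w bH w1.
have := EX_swap P _ bF.
rewrite (eq_EX P _ (fun=> EX P (fun t => H (simplex_coord (A t *m w))))); last first.
  move=> t /=; apply: EX_haar_left => //.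
  by apply: orthogonal_trmx; exact: haar_orthogonal.
rewrite EX_cst => ->; rewrite -[LHS](EX_cst P); apply: eq_EX => t' /=.
have [B oB BvE] : exists2 B, orthogonal_mx B & B *m v = A t' *m w.
  by apply: orthogonal_transitive => //; rewrite sqnorm_orthogonal //; exact: haar_orthogonal.
by rewrite -BvE EX_haar_tr_right.
Qed.

Lemma EX_haar_tperm H v m1 m2 : bfunctional H -> sqnorm v = 1 ->
  EX P (fun t => H (fun m => simplex_coord (A t *m v) (tperm m1 m2 m))) =
  EX P (fun t => H (simplex_coord (A t *m v))).
Proof.
move=> bH v1; have [B oB BE] := @simplex_coord_tperm R d M le_Md m1 m2.
by rewrite -(EX_haar_left _ _ _ bH v1 oB); apply: eq_EX => t; rewrite BE.
Qed.

(** By invariance [x] may be replaced by any basis vector, and the [d] squared coordinates of [A v]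
    sum to 1. *)
Lemma EX_haar_dot_sqr x v : sqnorm x = 1 -> sqnorm v = 1 ->
  EX P (fun t => dot x (A t *m v) ^+ 2) = d%:R^-1.
Proof.
move=> x1 v1.
have mdot y : measurable_fun [set: mx_space R d] (fun X : mx_space R d => dot y (X *m v) ^+ 2).
  apply: measurable_funX; apply: measurable_dot => j.
  by apply: measurable_mulmx_entry => // *; exact: measurable_mx_entry.
have dot1 y X : sqnorm y = 1 -> orthogonal_mx X -> `|dot y (X *m v) ^+ 2| <= 1.
  by move=> y1 oX; rewrite normrX exprn_ile1 // dot_le1 // sqnorm_orthogonal.
pose e_ j : 'cV[R]_d := delta_mx j 0.
have dot_e j y : dot (e_ j) y = y j 0.
  rewrite /dot (bigD1 j) //= !mxE !eqxx mul1r big1 ?addr0 // => i ij.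
  by rewrite mxE (negPf ij) mul0r.
have e1 j : sqnorm (e_ j) = 1 by rewrite sqnormE dot_e mxE !eqxx.
have xe j : EX P (fun t => dot x (A t *m v) ^+ 2) = EX P (fun t => dot (e_ j) (A t *m v) ^+ 2).
  have [B oB BE] := orthogonal_transitive _ _ (e1 j) x1.
  have := haar_EX_invariant _ _ _ haarA _ _ (mdot (e_ j)) _ (orthogonal_trmx _ oB).
  move=> <-; last by exists 1 => X; exact: dot1.
  by apply: eq_EX => t; rewrite -mulmxA [dot (e_ j) _]dotC dot_trmx BE [dot _ x]dotC.
have d0 : d%:R != 0 :> R by rewrite pnatr_eq0 -lt0n (leq_trans _ le_Md) // ltnW.
apply: (mulfI d0); rewrite divff // mulr_natl -[d in _ *+ d]card_ord -sumr_const.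
rewrite (eq_bigr _ (fun j _ => xe j)) -EX_sum.
  rewrite -[RHS](EX_cst P); apply: eq_EX => t; rewrite -v1.
  rewrite -(sqnorm_orthogonal (A t)); last exact: haar_orthogonal.
  by apply: eq_bigr => j _; rewrite dot_e.
move=> j; split; last by exists 1 => t; apply: dot1 => //; exact: haar_orthogonal.
apply: measurable_funX; apply: measurable_dot => i.
by apply: measurable_mulmx_entry => // *; exact: haar_measurable.
Qed.

End Law.

(** * The k-closest threshold and decorrelated inputs *)

Section Scores.
Context {R : realType} {dm : measure_display} {T : measurableType dm}.
Variables (P : probability T R) (d M : nat) (A : T -> 'M[R]_d).
Hypothesis haarA : haar_random_orthogonal P A.
Hypotheses (M_gt1 : (1 < M)%N) (le_Md : (M <= d)%N).
Variables (e : R) (v0 : 'cV[R]_d).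
Hypotheses (e_gt1 : 1 < e) (v0_unit : sqnorm v0 = 1).

Let M_gt0 : (0 < M)%N. Proof. exact: ltnW. Qed.

Let D_gt0 k : 0 < kden (M := M) e k :> R. Proof. exact: kden_gt0. Qed.

Definition mean_top_sum k : R := EX P (fun t => top_sum k (simplex_coord (M := M) (A t *m v0))).

(* the mean of [\sum_m <A s_m, v> * Q m] under [k]-closest encoding *)
Definition score k : R := (e - 1) / kden (M := M) e k * mean_top_sum k.

Let bmeas_top k : bmeas (fun t => top_sum k (simplex_coord (M := M) (A t *m v0))).
Proof. by apply: (bmeas_haar P) => //; exact: bfunctional_top_sum. Qed.

(** An alignment [a] has $|a| \le 1$, so $a^2 \le |a|$, which is at most [M] times the largest
    alignment; and $a^2$ has mean [1 / d]. *)
Lemma mean_top_sum1_gt0 : 0 < mean_top_sum 1.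
Proof.
pose i0 := Ordinal M_gt0.
have d_gt0 : (0 < d)%N by exact: leq_trans le_Md.
have bsqr : bmeas (fun t => dot (simplex_vec R d i0) (A t *m v0) ^+ 2).
  have := @bmeas_haar _ _ _ P d M A haarA M_gt1 le_Md (fun a => a i0 * a i0) v0.
  by apply=> // ? ? a ba; exact: bmeasM.
suff : d%:R^-1 <= M%:R * mean_top_sum 1.
  move=> h; rewrite -(pmulr_rgt0 _ (_ : 0 < M%:R)) ?ltr0n //.
  by apply: lt_le_trans h; rewrite invr_gt0 ltr0n.
rewrite -(EX_haar_dot_sqr P d M A haarA M_gt1 le_Md (simplex_vec R d i0) v0) //; last exact: sqnorm_simplex_vec.
rewrite -EXZ //; apply: le_EX => // [|t]; first exact: bmeasZ.
have c1 : `|simplex_coord (A t *m v0) i0| <= 1.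
  by apply: simplex_coord_le1 => //; rewrite sqnorm_orthogonal //; exact: (haar_orthogonal P).
apply: le_trans (normr_le_top_sum1 _ i0 _); last exact: sum_simplex_coord.
by rewrite -real_normK ?num_real // expr2 ler_piMl.
Qed.

Lemma ex_score_argmax : exists k, [/\ (0 < k < M)%N, 0 < score k &
  forall j, (j <= M)%N -> score j <= score k].
Proof.
apply: ex_interior_argmax => //.
- by rewrite /score /mean_top_sum; under eq_EX do rewrite top_sum0; rewrite EX_cst mulr0.
- rewrite /score /mean_top_sum; under eq_EX do rewrite top_sumT sum_simplex_coord //.
  by rewrite EX_cst mulr0.
- by rewrite /score !mulr_gt0 ?mean_top_sum1_gt0 ?invr_gt0 ?subr_gt0.
Qed.

Variable k : nat.
Hypothesis k_bounds : (0 < k < M)%N.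
Hypothesis score_max : forall j, (j <= M)%N -> score j <= score k.

Let mean_top_sumE j : (e - 1) * mean_top_sum j = score j * kden (M := M) e j.
Proof. by rewrite /score; field; rewrite gt_eqF. Qed.

Lemma ex_threshold : exists2 x : R, 0 <= x <= 1 &
  EX P (fun t => threshold x k (simplex_coord (M := M) (A t *m v0))) = score k.
Proof.
have /andP[k0 kM] := k_bounds.
have kdenS j : kden (M := M) e j.+1 = kden (M := M) e j + (e - 1) by rewrite /kden -natr1; ring.
have e1 : 0 < e - 1 by rewrite subr_gt0.
(* Multiplying [score k.+1 <= score k] by the normaliser for [k.+1], which is that for [k] plus
   [e - 1], leaves exactly this increment; [dn] is the same at [k.-1]. *)
have up : mean_top_sum k.+1 - mean_top_sum k <= score k.
  rewrite -(ler_pM2l e1) mulrBr !mean_top_sumE kdenS.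
  by have := ler_wpM2r (ltW (D_gt0 k.+1)) (score_max k.+1 kM); rewrite kdenS; lra.
have dn : score k <= mean_top_sum k - mean_top_sum k.-1.
  rewrite -(ler_pM2l e1) mulrBr !mean_top_sumE.
  have := ler_wpM2r (ltW (D_gt0 k.-1)) (score_max k.-1 (leq_trans (leq_pred _) (ltnW kM))).
  by have := kdenS k.-1; rewrite prednK // => ->; lra.
have [|x x01 xE] := ex_convex_comb (mean_top_sum k.+1 - mean_top_sum k) (score k)
    (mean_top_sum k - mean_top_sum k.-1); first by rewrite up dn.
exists x => //; rewrite -xE EXD ?EXZ ?EXB //; try exact: bmeasB.
  by apply: bmeasZ; exact: bmeasB.
by apply: bmeasZ; exact: bmeasB.
Qed.

Lemma EX_gain_threshold (x : R) (m : 'I_M) : 0 <= x <= 1 ->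
  EX P (fun t => threshold x k (simplex_coord (M := M) (A t *m v0))) = score k ->
  EX P (fun t => gain e (simplex_coord (A t *m v0) m - threshold x k (simplex_coord (M := M) (A t *m v0)))) = 0.
Proof.
move=> x01 xE; have /andP[k0 kM] := k_bounds.
pose H m (a : 'I_M -> R) := gain e (a m - threshold x k a).
have bH i : bfunctional (H i) by exact: bfunctional_gain.
(* Exchanging the indices [m] and [i] leaves the threshold unchanged and turns the gain of [m] into
   that of [i]. *)
have eqm i : EX P (fun t => H i (simplex_coord (A t *m v0))) = EX P (fun t => H m (simplex_coord (A t *m v0))).
  rewrite -(EX_haar_tperm P d M A haarA M_gt1 le_Md (H m) v0 m i (bH m) v0_unit).
  by apply: eq_EX => t; rewrite /H threshold_perm // tpermL.
have : \sum_(i < M) EX P (fun t => H i (simplex_coord (A t *m v0))) = 0.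
  rewrite -EX_sum; last by move=> i; apply: (bmeas_haar P).
  rewrite (eq_EX P _ (fun t => (e - 1) * top_sum k (simplex_coord (M := M) (A t *m v0)) -
      kden (M := M) e k * threshold x k (simplex_coord (M := M) (A t *m v0)))).
    have bthr : bmeas (fun t => threshold x k (simplex_coord (M := M) (A t *m v0))).
      by apply: (bmeas_haar P) => //; exact: bfunctional_threshold.
    by rewrite EXB ?EXZ ?xE //; [rewrite -/(mean_top_sum k) mean_top_sumE; ring | exact: bmeasZ | exact: bmeasZ].
  move=> t; rewrite /H.
  have [lo hi] := threshold_bounds x k (simplex_coord (M := M) (A t *m v0)) x01 k_bounds.
  by rewrite (sum_gain e k) // ?[kden _ _ * _]mulrC //; [exact: ltnW | exact: sum_simplex_coord].
rewrite (eq_bigr _ (fun i _ => eqm i)) sumr_const card_ord => /eqP.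
by rewrite mulrn_eq0 gtn_eqF // => /eqP.
Qed.

Lemma bmeas_comp_fst (f : T -> R) : bmeas f -> bmeas (fun p : T * T => f p.1).
Proof.
move=> [mf [K fK]]; split; last by exists K => p.
exact: (measurableT_comp mf measurable_fst).
Qed.

(* The points are chosen greedily: given the first [N], adding a random point [A(t') v0] increases
   the quantity by at most a constant on average, because the cross terms vanish. *)
Lemma ex_decorrelated_points (H : 'I_M -> ('I_M -> R) -> R) :
  (forall m, bfunctional (H m)) ->
  (forall m, EX P (fun t => H m (simplex_coord (A t *m v0))) = 0) ->
  exists K : R, forall N, exists2 V : nat -> 'cV[R]_d, forall i, sqnorm (V i) = 1 &
    EX P (fun t => \sum_m (\sum_(i < N) H m (simplex_coord ((A t)^T *m V i))) ^+ 2) <= N%:R * K.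
Proof.
move=> bH H0.
have bHv m : bmeas (fun t => H m (simplex_coord (A t *m v0))) by apply: (bmeas_haar P).
pose K0 := \sum_m EX P (fun t => H m (simplex_coord (A t *m v0)) ^+ 2).
(* A new point costs [K0] on average; the extra 1 gives the strict inequality that [EX_exists_le]
   asks for. *)
exists (K0 + 1); elim=> [|N [V V1 VN]].
  exists (fun=> v0) => //; rewrite mul0r.
  rewrite (eq_EX P _ (fun=> 0)) ?EX_cst // => t.
  by rewrite big1 // => m _; rewrite big_ord0 expr0n.
pose S m t := \sum_(i < N) H m (simplex_coord ((A t)^T *m V i)).
have bS m : bmeas (S m) by apply: bmeas_sum => i; apply: (bmeas_haar_tr P).
have bSqr f : bmeas f -> bmeas (fun t : T => f t ^+ 2 : R) by move=> bf; exact: bmeasM.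
pose F (p : T * T) := \sum_m (S m p.1 + H m (simplex_coord ((A p.1)^T *m (A p.2 *m v0)))) ^+ 2.
have bP m := bmeas_haar_pair P d M A haarA M_gt1 le_Md (H m) v0 (bH m) v0_unit.
have bF : bmeas F.
  apply: bmeas_sum => m; have bSH := bmeasD _ _ (bmeas_comp_fst _ (bS m)) (bP m).
  exact: (bmeasM _ _ bSH bSH).
have EF t : EX P (fun t' => F (t, t')) = \sum_m S m t ^+ 2 + K0.
  have oAt : orthogonal_mx (A t)^T by apply: orthogonal_trmx; exact: (haar_orthogonal P).
  have bG m : bmeas (fun t' => H m (simplex_coord ((A t)^T *m (A t' *m v0)))).
    exact: (bmeas_snd _ (bP m) t).
  rewrite /F /= EX_sum; last first.
    by move=> m; apply: bSqr; exact: (bmeasD _ _ (bmeas_cst (S m t)) (bG m)).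
  rewrite -big_split; apply: eq_bigr => m _ /=.
  rewrite (eq_EX P _ (fun t' => S m t ^+ 2 + (2 * S m t * H m (simplex_coord ((A t)^T *m (A t' *m v0)))
      + H m (simplex_coord ((A t)^T *m (A t' *m v0))) ^+ 2))); last by move=> t'; ring.
  have b1 : bmeas (fun t' => 2 * S m t * H m (simplex_coord ((A t)^T *m (A t' *m v0)))) by exact: bmeasZ.
  have b2 := bSqr _ (bG m).
  rewrite EXD; [|exact: bmeas_cst|exact: bmeasD].
  rewrite EXD // EX_cst EXZ //.
  rewrite (EX_haar_left P d M A haarA M_gt1 le_Md (H m)) // H0 mulr0 add0r.
  congr (_ + _); apply: (EX_haar_left P d M A haarA M_gt1 le_Md (fun a => H m a ^+ 2)) => //.
  by move=> ? ? a ba; apply: bmeasM; exact: bH.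
have [t' Ft'] : exists t', EX P (fun t => F (t, t')) <= N.+1%:R * (K0 + 1).
  apply: (EX_exists_le P); first exact: bmeas_EX_fst.
  rewrite -EX_swap //; under eq_EX do rewrite EF.
  have bSS : bmeas (fun t => \sum_m S m t ^+ 2) by apply: bmeas_sum => m; exact: bSqr.
  rewrite EXD //; last exact: bmeas_cst.
  by rewrite EX_cst -natr1 mulrDl mul1r; move: VN; rewrite /S; lra.
exists (fun i => if (i < N)%N then V i else A t' *m v0).
  by move=> i; case: ifP => // _; rewrite sqnorm_orthogonal //; exact: (haar_orthogonal P).
apply: le_trans Ft'; rewrite le_eqVlt; apply/orP; left; apply/eqP.
apply: eq_EX => t; apply: eq_bigr => m _; congr (_ ^+ 2).
rewrite big_ord_recr /= ltnn; congr (_ + _).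
by apply: eq_bigr => i _; rewrite ltn_ord.
Qed.

End Scores.

(** * Encoders *)

Section Encoders.
Context {R : realType} {dm : measure_display} {T : measurableType dm}.
Variables (P : probability T R) (d M : nat) (A : T -> 'M[R]_d).
Hypothesis haarA : haar_random_orthogonal P A.
Hypotheses (M_gt1 : (1 < M)%N) (le_Md : (M <= d)%N).

Let orthA t : orthogonal_mx (A t). Proof. exact: (haar_orthogonal P). Qed.

Lemma dot_codebook (r : R) t m (x : 'cV[R]_d) :
  dot (simplex_codebook d M r (A t) m) x = r * simplex_coord ((A t)^T *m x) m.
Proof.
by rewrite dotC /simplex_codebook dotZr /simplex_coord [dot _ ((A t)^T *m x)]dotC dot_trmx.
Qed.

Lemma sqnorm_codebookB (r : R) t m (x : 'cV[R]_d) : sqnorm x = 1 ->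
  sqnorm (simplex_codebook d M r (A t) m - x) =
  r ^+ 2 + 1 - 2 * r * simplex_coord ((A t)^T *m x) m.
Proof.
move=> x1; rewrite sqnormB x1 dot_codebook sqnormE dot_codebook.
rewrite /simplex_codebook -scalemxAr mulmxA (orthA t) mul1mx /simplex_coord dotZr.
by rewrite -sqnormE sqnorm_simplex_vec //; ring.
Qed.

Variables (r : R) (Q : encoder R d M).
Hypothesis r_gt0 : 0 < r.
Let U t := simplex_codebook d M r (A t).
Hypothesis encQ : random_encoder U Q.

Lemma bmeas_encoder v m : bmeas (fun t => Q v (U t) m).
Proof.
have [Q0 Q1 mQ] := encQ; split; first exact: mQ.
exists 1 => t; rewrite ger0_norm // -(Q1 v (U t)) (bigD1 m) //= lerDl.
exact: sumr_ge0.
Qed.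

Lemma bmeas_simplex_coord_tr v (m : 'I_M) : sqnorm v = 1 ->
  bmeas (fun t => simplex_coord ((A t)^T *m v) m).
Proof.
by move=> v1; apply: (bmeas_haar_tr P d M A haarA M_gt1 le_Md (fun a => a m)) => // ? ? a; apply.
Qed.

Lemma bmeas_codebook_entry m j : bmeas (fun t => U t m j 0).
Proof.
pose e_ : 'cV[R]_d := delta_mx j 0.
have dot_e y : dot y e_ = y j 0.
  rewrite /dot (bigD1 j) //= !mxE !eqxx mulr1 big1 ?addr0 // => i ij.
  by rewrite mxE (negPf ij) mulr0.
under eq_fun do rewrite -dot_e dot_codebook.
by apply: bmeasZ; apply: bmeas_simplex_coord_tr; rewrite sqnormE dot_e mxE !eqxx.
Qed.

Hypothesis unbQ : unbiased P U Q.

(** Pair the unbiasedness identity with [v] itself: the right side becomes [sqnorm v = 1], and the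
    left side is [r] times the mean alignment. *)
Lemma unbiased_alignment v : sqnorm v = 1 ->
  EX P (fun t => \sum_m simplex_coord ((A t)^T *m v) m * Q v (U t) m) = r^-1.
Proof.
move=> v1; have bUQ j : bmeas (fun t => \sum_(m < M) U t m j 0 * Q v (U t) m).
  by apply: bmeas_sum => m; apply: bmeasM; [exact: bmeas_codebook_entry | exact: bmeas_encoder].
have unbE j : EX P (fun t => \sum_(m < M) U t m j 0 * Q v (U t) m) = v j 0.
  by apply: EFin_inj; rewrite -integral_EX // unbQ.
apply: (mulfI (lt0r_neq0 r_gt0)); rewrite divff ?lt0r_neq0 // -EXZ; last first.
  by apply: bmeas_sum => m; apply: bmeasM; [exact: bmeas_simplex_coord_tr | exact: bmeas_encoder].
rewrite -v1 sqnormE /dot; under [RHS]eq_bigr => j _ do rewrite -[X in _ * X]unbE -EXZ //.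
rewrite -EX_sum; last by move=> j; exact: bmeasZ.
apply: eq_EX => t; rewrite mulr_sumr; under [RHS]eq_bigr do rewrite mulr_sumr.
rewrite exchange_big /=; apply: eq_bigr => m _.
by rewrite mulrA -dot_codebook mulr_suml; apply: eq_bigr => j _; rewrite mulrCA mulrA.
Qed.

(** All codewords have norm [r], so the error is $r^2 + 1$ minus $2 r$ times the mean alignment
    [1 / r]. Among unbiased schemes, comparing errors thus amounts to comparing radii. *)
Lemma unbiased_error v : sqnorm v = 1 ->
  (\int[P]_t (\sum_(m < M) sqnorm (U t m - v) * Q v (U t) m)%:E = (r ^+ 2 - 1)%:E)%E.
Proof.
move=> v1; have [_ Q1 _] := encQ.
have b : bmeas (fun t => \sum_m simplex_coord ((A t)^T *m v) m * Q v (U t) m).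
  by apply: bmeas_sum => m; apply: bmeasM; [exact: bmeas_simplex_coord_tr | exact: bmeas_encoder].
have E t : \sum_(m < M) sqnorm (U t m - v) * Q v (U t) m =
    (r ^+ 2 + 1) + (- 2 * r) * (\sum_m simplex_coord ((A t)^T *m v) m * Q v (U t) m).
  have -> : r ^+ 2 + 1 = \sum_m (r ^+ 2 + 1) * Q v (U t) m by rewrite -mulr_sumr Q1 mulr1.
  rewrite mulr_sumr -big_split /=.
  by apply: eq_bigr => m _; rewrite sqnorm_codebookB //; ring.
under eq_integral do rewrite E.
rewrite integral_EX; last by apply: bmeasD; [exact: bmeas_cst | exact: bmeasZ].
rewrite EXD ?EX_cst ?EXZ ?unbiased_alignment //; [|exact: bmeas_cst|exact: bmeasZ].
by congr EFin; field; rewrite lt0r_neq0.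
Qed.

End Encoders.

(** * Converse bound and achievability *)

Section Optimality.
Context {R : realType} {dm : measure_display} {T : measurableType dm}.
Variables (P : probability T R) (d M : nat) (A : T -> 'M[R]_d).
Hypothesis haarA : haar_random_orthogonal P A.
Hypotheses (M_gt1 : (1 < M)%N) (le_Md : (M <= d)%N).
Variables (eps : R) (v0 : 'cV[R]_d) (k : nat).
Hypotheses (eps_gt0 : 0 < eps) (v0_unit : sqnorm v0 = 1).
Let e := expR eps.
Let c := score P d M A e v0 k.
Hypotheses (k_bounds : (0 < k < M)%N)
  (score_max : forall j, (j <= M)%N -> score P d M A e v0 j <= c).

Let e_gt1 : 1 < e. Proof. by rewrite expR_gt1. Qed.

Lemma LDP_alignment_le (r : R) (Q : encoder R d M) : 0 < r ->
  let U t := simplex_codebook d M r (A t) in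
  random_encoder U Q -> unbiased P U Q -> is_LDP P U Q eps -> r^-1 <= c.
Proof.
move=> r0 U encQ unbQ ldpQ; have [Q0 Q1 mQ] := encQ.
have [x x01 xE] := ex_threshold P d M A haarA M_gt1 le_Md e v0 e_gt1 v0_unit k k_bounds score_max.
pose H m (a : 'I_M -> R) := gain e (a m - threshold x k a).
have bH m : bfunctional (H m) by exact: bfunctional_gain.
have [|K HK] := ex_decorrelated_points P d M A haarA M_gt1 le_Md v0 v0_unit H bH.
  by move=> m; apply: (EX_gain_threshold P d M A haarA M_gt1 le_Md).
pose a (V : nat -> 'cV[R]_d) i t : 'I_M -> R := simplex_coord ((A t)^T *m V i).
(* For a fixed codebook, let [p m] be the minimum of the probability of [m] over the [N.+1] points.
   Adding the dual bounds over the points, [p m] factors out of the sum of the gains of [m], and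
   [0 <= p m <= 1] leaves its absolute value. *)
have pointwise N (V : nat -> 'cV[R]_d) : (forall i, sqnorm (V i) = 1) ->
    {ae P, forall t, \sum_(i < N.+1) \sum_m a V i t m * Q (V i) (U t) m <=
      \sum_(i < N.+1) threshold x k (a V i t) + \sum_m `|\sum_(i < N.+1) H m (a V i t)|}.
  move=> V1.
  (* The null set in the privacy condition depends on the pair of inputs; here only countably many
     pairs occur. *)
  have : {ae P, forall t, forall i i' m, Q (V i) (U t) m <= e * Q (V i') (U t) m}.
    apply/ae_foralln => i; apply/ae_foralln => i'.
    by apply: filter_forall => m; exact: ldpQ.
  apply: filterS => t ldp.
  have [p pP] : exists p : 'I_M -> R, forall m, 0 <= p m <= 1 /\
      forall i : 'I_N.+1, p m <= Q (V i) (U t) m <= e * p m.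
    suff pm m : exists p : R, 0 <= p <= 1 /\
        forall i : 'I_N.+1, p <= Q (V i) (U t) m <= e * p.
      by have [p pP] := boolp.choice pm; exists p.
    case: (@Order.TotalTheory.arg_minP _ _ 'I_N.+1 ord0 xpredT (fun i => Q (V i) (U t) m) isT).
    move=> i0 _ i0_min; exists (Q (V i0) (U t) m); split.
      rewrite Q0 /= -(Q1 (V i0) (U t)) (bigD1 m) //= lerDl.
      exact: sumr_ge0.
    by move=> i; rewrite i0_min // ldp.
  apply: (@le_trans _ _ (\sum_(i < N.+1) (threshold x k (a V i t) + \sum_m p m * H m (a V i t)))).
    apply: ler_sum => i _; apply: linprog_dual_bound => // m.
    by have [_ /(_ i)] := pP m.
  rewrite big_split /= lerD2l exchange_big /=; apply: ler_sum => m _.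
  rewrite -mulr_sumr; have [/andP[p0 p1] _] := pP m.
  by apply: le_trans (ler_norm _) _; rewrite normrM ger0_norm // ler_piMl.
rewrite leNgt; apply/negP => gap; set D := r^-1 - c.
have D0 : 0 < D by rewrite subr_gt0.
(* The total excess [N.+1 * D] is at most the mean of the sum of the [|S m|]. The variance bound
   makes that mean of order $\sqrt N$; after half of the excess is absorbed, a bound independent of
   [N] remains, which fails for large [N]. *)
have boundN N : N.+1%:R * D <= K * M%:R / D.
  have [V V1 VK] := HK N.+1.
  have ba i : forall m, bmeas (fun t => a V i t m).
    by move=> m; apply: (bmeas_simplex_coord_tr P).
  have bQ i m : bmeas (fun t => Q (V i) (U t) m) by exact: (bmeas_encoder d M A r Q encQ).
  pose S m t := \sum_(i < N.+1) H m (a V i t).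
  have bS m : bmeas (S m) by apply: bmeas_sum => i; exact: bH.
  have bthr i : bmeas (fun t => threshold x k (a V i t)) by exact: bfunctional_threshold.
  have baQ i : bmeas (fun t => \sum_m a V i t m * Q (V i) (U t) m).
    by apply: bmeas_sum => m; exact: bmeasM.
  have bSS : bmeas (fun t => \sum_m S m t ^+ 2) by apply: bmeas_sum => m; exact: bmeasM.
  have bthrs : bmeas (fun t => \sum_(i < N.+1) threshold x k (a V i t)) by exact: bmeas_sum.
  have babs : bmeas (fun t => \sum_m `|S m t|) by apply: bmeas_sum => m; exact: bmeas_norm.
  have baQs : bmeas (fun t => \sum_(i < N.+1) \sum_m a V i t m * Q (V i) (U t) m) by exact: bmeas_sum.
  have := le_EX_ae P _ _ baQs (bmeasD _ _ bthrs babs) (pointwise N V V1).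
  rewrite EX_sum // EXD // EX_sum //.
  rewrite (eq_bigr (fun=> r^-1)); last first.
    by move=> i _; apply: (unbiased_alignment P d M A haarA M_gt1 le_Md).
  rewrite [X in _ <= X + _](eq_bigr (fun=> c)); last first.
    move=> i _; rewrite -[RHS]xE.
    by apply: (EX_haar_tr P d M A haarA M_gt1 le_Md (threshold x k)) => //; exact: bfunctional_threshold.
  rewrite !sumr_const card_ord -[r^-1 *+ N.+1]mulr_natl -[c *+ N.+1]mulr_natl -lerBlDl -mulrBr -/D.
  set n : R := N.+1%:R; have n0 : 0 < n by rewrite ltr0n.
  have M0 : 0 < M%:R :> R by rewrite ltr0n ltnW.
  (* [|S| <= S^2 / (2 y) + y / 2] with [y = n D / M] *)
  have : EX P (fun t => \sum_m `|S m t|) <=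
      EX P (fun t => M%:R / (2 * n * D) * (\sum_m S m t ^+ 2) + n * D / 2).
    apply: le_EX => // [|t]; first by apply: bmeasD; [exact: bmeasZ | exact: bmeas_cst].
    rewrite (_ : n * D / 2 = \sum_(m < M) (n * D / (2 * M%:R))); last first.
      by rewrite sumr_const card_ord -[(_ / _) *+ M]mulr_natl; field; rewrite gt_eqF.
    rewrite mulr_sumr -big_split /=; apply: ler_sum => m _.
    rewrite -(real_normK (num_real (S m t))) -subr_ge0.
    rewrite (_ : _ - _ = M%:R / (2 * n * D) * (`|S m t| - n * D / M%:R) ^+ 2); last first.
      by field; rewrite !gt_eqF.
    by rewrite mulr_ge0 ?sqr_ge0 // divr_ge0 ?mulr_ge0 // ltW.
  rewrite EXD ?EX_cst ?EXZ //; [|exact: bmeasZ|exact: bmeas_cst].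
  have cpos : 0 <= M%:R / (2 * n * D) by rewrite divr_ge0 ?mulr_ge0 // ltW.
  have VK' : EX P (fun t => \sum_m S m t ^+ 2) <= n * K by exact: VK.
  have := ler_wpM2l cpos VK'; rewrite (_ : _ * (n * K) = K * M%:R / D / 2); last first.
    by field; rewrite !gt_eqF.
  move: (_ * EX P (fun t => \sum_m S m t ^+ 2)) => y hy absy ndy.
  have := le_trans ndy absy; lra.
have X0 : 0 <= K * M%:R / D / D.
  by rewrite divr_ge0 ?(ltW D0) // (le_trans _ (boundN 0%N)) // mulr_ge0 // ltW.
have := archi_boundP X0; set N := Num.Def.archi_bound _ => hN.
have := boundN N; rewrite -ler_pdivlMr // leNgt => /negP; apply.
by apply: lt_trans hN _; rewrite ltr_nat.
Qed.

(** * The [k]-closest encoding attains the bound *)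

Section Achievability.
Import numFieldNormedType.Exports.
Variable r : R.
Hypothesis r_gt0 : 0 < r.
Let U t := simplex_codebook d M r (A t).
Let Q := kclosest d M eps (k%:R : R).

(** For an integer [k] the fractional part vanishes, so the intermediate weight at rank [k] (the
    [k+1]-st closest) coincides with the smallest weight. *)
Lemma kclosestE v u m : Q v u m = kweight e k (fun i => - sqnorm (v - u i)) m.
Proof.
rewrite /Q /kclosest /kweight /top_rank; under [in RHS]eq_fun do rewrite opprK.
have -> : Num.floor (k%:R : R) = k%:Z by rewrite -[k%:R]/(k%:Z%:~R) intrKfloor.
have -> : k%:R * expR eps + M%:R - k%:R = kden (M := M) e k by rewrite /kden /e; ring.
rewrite ltz_nat eqz_nat; case: ifP => // _; case: ifP => // _.
by rewrite subrr mul0r add0r.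
Qed.

(** All codewords have the same norm and [r > 0], so the smallest distances are the largest
    alignments. *)
Lemma kclosest_codebook v t m : sqnorm v = 1 ->
  Q v (U t) m = kweight e k (simplex_coord ((A t)^T *m v)) m.
Proof.
move=> v1; rewrite kclosestE /kweight.
suff -> : top_rank (fun i => - sqnorm (v - U t i)) m = top_rank (simplex_coord ((A t)^T *m v)) m by [].
apply: eq_dist_rank => i j; rewrite !opprK.
have dE l : sqnorm (v - U t l) = r ^+ 2 + 1 - 2 * r * simplex_coord ((A t)^T *m v) l.
  rewrite -(sqnorm_codebookB P d M A haarA M_gt1 le_Md) // !sqnormB [dot v _]dotC.
  by rewrite [sqnorm v + _]addrC.
rewrite !dE ltrD2l !ltrN2 ltr_pM2l //.
by rewrite mulr_gt0.
Qed.

Let kweight_ge0 a (m : 'I_M) : 0 <= kweight e k a m.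
Proof.
rewrite divr_ge0 //; first by case: ifP => _ //; rewrite ltW // (lt_trans ltr01).
by rewrite ltW // kden_gt0 // ltnW.
Qed.

Lemma kclosest_random_encoder : random_encoder U Q.
Proof.
have kM : (k <= M)%N by case/andP: k_bounds => _ /ltnW.
split=> [v u m|v u|v m]; first by rewrite kclosestE.
  by under eq_bigr do rewrite kclosestE; rewrite sum_kweight // ltnW.
under eq_fun do rewrite kclosestE /kweight.
apply: measurable_funM => //; apply: measurable_fun_ifT => //.
apply: measurable_top_rank_lt => i; apply: measurableT_comp => //.
apply: measurable_sum => j; apply: measurable_funX.
rewrite (_ : (fun t => (v - U t i) j 0) = (fun t => v j 0 - U t i j 0)); last first.
  by apply/funext => t; rewrite !mxE.
apply: measurable_funB => //.
by have [] := bmeas_codebook_entry P d M A haarA M_gt1 le_Md r i j.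
Qed.

Lemma kclosest_LDP : is_LDP P U Q eps.
Proof.
move=> v v' m _ _; apply: aeW => t; rewrite !kclosestE /kweight mulrA.
apply: ler_wpM2r; first by rewrite invr_ge0 ltW // kden_gt0 // ltnW.
rewrite -/e; have e0 : 1 <= e by exact: ltW.
have ee : e <= e * e by rewrite ler_peMl // (le_trans ler01).
by case: ifP => _; case: ifP => _; rewrite ?mulr1 // (le_trans e0).
Qed.

Hypothesis rE : r = c^-1.

Lemma kclosest_unbiased : unbiased P U Q.
Proof.
move=> v v1 j; have v1' : sqnorm v = 1 := v1.
pose x : 'cV[R]_d := delta_mx j 0.
have dot_x y : dot x y = y j 0.
  rewrite /dot (bigD1 j) //= !mxE !eqxx mul1r big1 ?addr0 // => i ij.
  by rewrite mxE (negPf ij) mul0r.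
have x1 : sqnorm x = 1 by rewrite sqnormE dot_x mxE !eqxx.
pose al (X : 'M[R]_d) (m : 'I_M) := simplex_coord (X^T *m v) m.
(* On an orthogonal [X], [r * h X] is the [j]-th coordinate of the mean decoded vector given that
   the rotation is [X]. *)
pose h (X : 'M[R]_d) := \sum_m clip (dot x (X *m simplex_vec R d m)) *
  kweight e k (fun m' => clip (al X m')) m.
have hE X : orthogonal_mx X -> h X = \sum_m dot x (X *m simplex_vec R d m) * kweight e k (al X) m.
  move=> oX; apply: eq_bigr => m _; rewrite clip_id; last first.
    by apply: dot_le1 => //; rewrite sqnorm_orthogonal // sqnorm_simplex_vec.
  congr (_ * kweight e k _ m); apply/funext => i; rewrite clip_id //.
  by apply: simplex_coord_le1 => //; rewrite sqnorm_orthogonal //; exact: orthogonal_trmx.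
have bh : bmeas (h : mx_space R d -> R).
  apply: bmeas_sum => m; apply: bmeasM.
    apply: bmeas_clip; apply: measurable_dot => i.
    by apply: measurable_mulmx_entry => // *; exact: measurable_mx_entry.
  apply: (bfunctional_kweight e k m) => i; apply: bmeas_clip; apply: measurable_dot => l.
  apply: measurable_mulmx_entry => // *; under eq_fun do rewrite mxE.
  exact: measurable_mx_entry.
have mA : measurable_fun [set: T] (A : T -> mx_space R d).
  by apply: measurable_to_mx => i l; exact: (haar_measurable P).
have bhA : bmeas (fun t => h (A t)).
  by case: bh => mh [K hK]; split; [exact: (measurableT_comp mh mA) | exists K => t].
have btop : bmeas (fun t => \sum_m al (A t) m * kweight e k (al (A t)) m).
  apply: bmeas_sum => m; apply: (bmeas_haar_tr P d M A haarA M_gt1 le_Md (fun a => a m * kweight e k a m)) => //.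
  by move=> ? ? a ba; apply: bmeasM => //; exact: bfunctional_kweight.
have topE : EX P (fun t => \sum_m al (A t) m * kweight e k (al (A t)) m) = c.
  under eq_EX do rewrite sum_mul_kweight ?sum_simplex_coord //.
  have btop' := bmeas_haar_tr P d M A haarA M_gt1 le_Md _ v (bfunctional_top_sum (M := M) k) v1.
  rewrite EXZ // /c /score; congr (_ * _).
  by apply: (EX_haar_tr P d M A haarA M_gt1 le_Md) => //; exact: bfunctional_top_sum.
(* [- reflection_mx 2 v] fixes [v] and negates its orthogonal complement *)
pose B : 'M[R]_d := - reflection_mx 2 v.
have BE y : B *m y = (2 * dot v y) *: v - y.
  by rewrite /B mulNmx reflection_mxE opprB.
have oB : orthogonal_mx B.
  have := @reflection_mx_orthogonal R d 2 v; rewrite v1' mulr1 => /(_ erefl).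
  rewrite /orthogonal_mx /B; set F := reflection_mx 2 v.
  by have -> : (- F)^T = - F^T; [apply/matrixP => i l; rewrite !mxE | rewrite mulNmx mulmxN opprK].
have Bv : B^T *m v = v.
  have Bv : B *m v = v by rewrite BE -sqnormE v1' mulr1 scaler_nat mulr2n addrK.
  by rewrite -{1}Bv mulmxA oB mul1mx.
(* As [B^T v = v], replacing [A] by [B A] keeps all alignments and hence the weights, while it
   reflects the decoded vector. Taking means, invariance yields $E h = 2 v_j c - E h$. *)
have hB t : h (B *m A t) = 2 * v j 0 * (\sum_m al (A t) m * kweight e k (al (A t)) m) - h (A t).
  have oA := haar_orthogonal P d A haarA t.
  rewrite !hE //; last exact: orthogonal_mul.
  rewrite mulr_sumr -sumrB; apply: eq_bigr => m _.
  have -> : al (B *m A t) = al (A t).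
    by apply/funext => i; rewrite /al trmx_mul -mulmxA Bv.
  rewrite -mulmxA BE dotDr dotZr dotNr dot_x /al /simplex_coord.
  by rewrite [dot (simplex_vec _ _ _) _]dotC dot_trmx; ring.
have := haar_EX_invariant P d A haarA h B; case: (bh) => mh [K hK].
move=> /(_ mh (ex_intro _ K (fun X _ => hK X)) oB).
under eq_EX do rewrite hB.
rewrite EXB ?EXZ ?topE //; last exact: bmeasZ.
move=> hinv; have EhA : EX P (fun t => h (A t)) = v j 0 * c by lra.
have c0 : c != 0 by rewrite -invr_eq0 -rE gt_eqF.
under eq_integral => t _.
  rewrite (_ : \sum_(m < M) _ = r * h (A t)); last first.
    rewrite hE; last exact: (haar_orthogonal P).
    rewrite mulr_sumr; apply: eq_bigr => m _.
    by rewrite kclosest_codebook // dot_x mxE mulrA.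
  over.
rewrite integral_EX; last exact: bmeasZ.
by rewrite EXZ // EhA rE mulrCA mulVf // mulr1.
Qed.

End Achievability.


End Optimality.

(** * Comparison of radii and of worst-case errors *)

Theorem theorem1 (R : realType) (d b : nat) (eps : R)
    (dm : measure_display) (T : measurableType dm) (P : probability T R)
    (A : T -> 'M[R]_d) :
  (1 <= d)%N -> (1 <= b)%N -> (2 ^ b < d)%N -> 0 < eps ->
  haar_random_orthogonal P A ->
  exists (k r : R),
    [/\ 0 <= k <= (2 ^ b)%:R, 0 < r &
    [/\         random_encoder (fun t => simplex_codebook d (2 ^ b) r (A t))
                       (kclosest d (2 ^ b) eps k),
        unbiased P (fun t => simplex_codebook d (2 ^ b) r (A t))
                 (kclosest d (2 ^ b) eps k),
        is_LDP P (fun t => simplex_codebook d (2 ^ b) r (A t))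
               (kclosest d (2 ^ b) eps k) eps &
        forall (r' : R) (Q : encoder R d (2 ^ b)), 0 < r' ->
          random_encoder (fun t => simplex_codebook d (2 ^ b) r' (A t)) Q ->
          unbiased P (fun t => simplex_codebook d (2 ^ b) r' (A t)) Q ->
          is_LDP P (fun t => simplex_codebook d (2 ^ b) r' (A t)) Q eps ->
          (worst_err P (fun t => simplex_codebook d (2 ^ b) r (A t))
                     (kclosest d (2 ^ b) eps k)
           <= worst_err P (fun t => simplex_codebook d (2 ^ b) r' (A t)) Q)%E]].
Proof.
move=> d_gt0 b_gt0 lt_Md eps_gt0 haarA; set M := (2 ^ b)%N.
have M_gt1 : (1 < M)%N by rewrite -{1}(expn0 2) ltn_exp2l.
have le_Md : (M <= d)%N by exact: ltnW.
(* A reference input; by [EX_haar_tr] the law of the alignments is the same for every unit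
   vector. *)
pose v0 : 'cV[R]_d := delta_mx (Ordinal d_gt0) 0.
have v0_unit : sqnorm v0 = 1.
  rewrite /sqnorm (bigD1 (Ordinal d_gt0)) //= !mxE !eqxx expr1n big1 ?addr0 // => i ne_i0.
  by rewrite mxE (negPf ne_i0) expr0n.
have e_gt1 : 1 < expR eps by rewrite expR_gt1.
have [k [k_bounds score_gt0 score_max]] :=
  ex_score_argmax P d M A haarA M_gt1 le_Md (expR eps) v0 e_gt1 v0_unit.
set c := score P d M A (expR eps) v0 k in score_gt0 score_max.
have r_gt0 : 0 < c^-1 by rewrite invr_gt0.
have encK := kclosest_random_encoder P d M A haarA M_gt1 le_Md eps k eps_gt0 k_bounds c^-1.
have unbK := kclosest_unbiased P d M A haarA M_gt1 le_Md eps v0 k v0_unit _ r_gt0 erefl.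
exists k%:R, c^-1; split=> //.
  by rewrite ler0n ler_nat; case/andP: k_bounds => _ /ltnW.
split=> //; first exact: kclosest_LDP.
move=> r' Q r'_gt0 encQ unbQ ldpQ.
(* The chosen radius is the reciprocal of the maximal mean alignment, so it is the smallest radius
   of an unbiased private scheme. *)
have r_le : c^-1 <= r'.
  rewrite -[r']invrK lef_pV2 ?posrE ?invr_gt0 //.
  exact: (LDP_alignment_le P d M A haarA M_gt1 le_Md eps v0 k eps_gt0 v0_unit k_bounds score_max r' Q).
(* The error does not depend on the input: the first supremum is bounded at every [v], the second
   from below at [v0] alone. *)
apply: (@le_trans _ _ (r' ^+ 2 - 1)%:E).
  apply: ge_ereal_sup => _ [v v1 <-].
  rewrite (unbiased_error P d M A haarA M_gt1 le_Md c^-1 _ r_gt0 encK unbK v v1) lee_fin.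
  by rewrite lerD2r ler_sqr ?nnegrE // ltW.
apply: ereal_sup_ubound; exists v0 => //.
exact: (unbiased_error P d M A haarA M_gt1 le_Md r' Q r'_gt0 encQ unbQ v0 v0_unit).
Qed.
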